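(* Let $\Omega\subset\mathbb{R}^d$ be an open domain and let $\mathcal{L}$ be a closed, densely defined linear operator on $L^2(\Omega)$ with domain $D(\mathcal{L})$ such that the evolution equation $$\partial_t w+\mathcal{L}w=f,\qquad w|_{t=0}=w(0,x),\qquad (t,x)\in\mathbb{R}_+\times\Omega,$$ is governed by a strongly continuous semigroup $\{e^{-t\mathcal{L}}\}_{t\ge0}$ on $L^2(\Omega)$. Assume that this equation has a fundamental solution $p_{\mathcal{L}}(t,x,y)\in C^\infty(\mathbb{R}_+\times\Omega\times\Omega)$, in the sense that for any $w(0,\cdot)\in C^\infty_c(\Omega)$ and $f\in C_c^\infty(\mathbb{R}_+\times\Omega)$ the mild solution is represented as $$w(t,x)=\int_\Omega p_{\mathcal{L}}(t,x,y)\,w(0,y)\,dy+\int_0^t\int_\Omega p_{\mathcal{L}}(t-s,x,y)f(s,y)\,dy\,ds. \qquad ( * )$$ Assume in addition that the support of $p_{\mathcal{L}}$ is $\mathbb{R}_+\times\Omega\times\Omega$. Then for any positive continuous functions $a_1,a_2:\Omega\to(0,\infty)$ and any non-constant continuous function $\phi:\Omega\to\mathbb{R}$, there exists a sequence $\{(w_n,f_n)\}_{n\in\mathbb{N}}$ such that each $(w_n,f_n)$ satisfies $( * )$ with $w_n(0,x)=0$, that is, $$w_n(t,x)=\int_0^t\int_\Omega p_{\mathcal{L}}(t-s,x,y)f_n(s,y)\,dy\,ds,$$ and for every $n\in\mathbb{N}$ $$f_n\in C_c^\infty(\mathbb{R}_+\times\Omega),\qquad \|e^{t\phi(x)}a_2(x)f_n\|_{L^2((0,\infty)\times\Omega)}<+\infty,$$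 but $$\limsup_{n\to+\infty}\frac{\|e^{t\phi(x)}a_1(x)w_n\|_{L^2((0,\infty)\times\Omega)}}{\|e^{t\phi(x)}a_2(x)f_n\|_{L^2((0,\infty)\times\Omega)}}=+\infty.$$
   Context: $\mathbb{R}_+=(0,\infty)$. Functions $w,f,p_{\mathcal{L}}$ are complex-valued. The support of $p_{\mathcal{L}}$ is the closure, relative to $\mathbb{R}_+\times\Omega\times\Omega$, of the set where $p_{\mathcal{L}}\neq0$. The mild solution is $w(t)=e^{-t\mathcal{L}}w(0)+\int_0^t e^{-(t-s)\mathcal{L}}f(s)\,ds$. The norm in the numerator of the quotient is allowed to take the value $+\infty$ (in which case the quotient is $+\infty$). *)

(* Defs.v *)
From HB Require Import structures.
From mathcomp Require Import all_boot all_order all_algebra.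
From mathcomp Require Import all_classical all_reals all_analysis measurable_realfun.
From mathcomp Require Import complex.
Set Implicit Arguments.
Unset Strict Implicit.
Unset Printing Implicit Defensive.
Import Order.TTheory GRing.Theory Num.Theory.
Import numFieldNormedType.Exports ComplexField.Normc.
Local Open Scope classical_set_scope.
Local Open Scope complex_scope.
Local Open Scope ring_scope.

(* R^d is 'rV[R]_d: its topology is that of the sup norm, its sigma-algebra is
   generated by the coordinates (hence Borel), and its Lebesgue measure is the
   iterated product of the one-dimensional one. *)
Definition rV_display : measure_display. Proof. exact. Qed.

Section measurable_rV.
Context {R : realType} (d : nat).

Let coord : 'I_d -> 'rV[R]_d -> R := fun i x => x ord0 i.

Let rV_set0 : g_sigma_preimage coord set0.
Proof. exact: sigma_algebra0. Qed.

Let rV_setC A : g_sigma_preimage coord A -> g_sigma_preimage coord (~` A).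
Proof. exact: sigma_algebraC. Qed.

Let rV_bigcup (F : _^nat) : (forall i, g_sigma_preimage coord (F i)) ->
  g_sigma_preimage coord (\bigcup_i F i).
Proof. exact: sigma_algebra_bigcup. Qed.

HB.instance Definition _ := @isMeasurable.Build rV_display
  'rV[R]_d (g_sigma_preimage coord) rV_set0 rV_setC rV_bigcup.

Lemma measurable_coord (i : 'I_d) :
  measurable_fun [set: 'rV[R]_d] (fun x => x ord0 i).
Proof.
move=> _ Y mY; rewrite setTI; apply: sub_sigma_algebra => /=.
rewrite -bigcup_seq/=; exists i => /=; first by rewrite mem_index_enum.
by exists Y => //; rewrite setTI.
Qed.

Lemma measurable_fun_rV d1 (T : measurableType d1) (f : T -> 'rV[R]_d) :
  (forall i, measurable_fun setT (fun x => f x ord0 i)) ->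
  measurable_fun setT f.
Proof.
move=> mf.
have prefS : g_sigma_preimage (fun i => coord i \o f) `<=` measurable.
  apply: smallest_sub; first exact: sigma_algebra_measurable.
  rewrite -bigcup_seq; apply: bigcup_sub => i _ A [B mB <-].
  exact: mf.
rewrite g_sigma_preimage_comp in prefS.
by move=> _ A mA; apply: prefS; exists A.
Qed.

Lemma open_measurable_rV (U : set 'rV[R]_d) : open U -> measurable U.
Proof.
move=> oU.
pose cube (q : 'rV[rat]_d * nat) : set 'rV[R]_d :=
  [set x | forall i, `|ratr (q.1 ord0 i) - x ord0 i| < q.2.+1%:R^-1].
have mcube q : measurable (cube q).
  have -> : cube q = \big[setI/setT]_(i < d)
      ((fun x : 'rV[R]_d => x ord0 i) @^-1`
        ball (ratr (q.1 ord0 i) : R) q.2.+1%:R^-1).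
    rewrite -bigcap_seq; apply/seteqP; split=> [x qx i _|x qx i]; first exact: qx.
    by apply: (qx i); rewrite /= mem_index_enum.
  apply: bigsetI_measurable => i _; rewrite -[X in measurable X]setTI.
  by apply: measurable_coord => //; exact: measurable_ball.
pose D := [set q | cube q `<=` U].
have -> : U = \bigcup_(q in D) cube q.
  apply/seteqP; split=> [x Ux|x [q Dq]]; last exact: Dq.
  have /nbhs_ballP[e /= e0 eU] : nbhs x U by exact: open_nbhs_nbhs.
  have [n ne] : exists n : nat, n.+1%:R^-1 + n.+1%:R^-1 < e.
    have [n _ /(_ n (leqnn _)) H] := near_infty_natSinv_lt (PosNum (divr_gt0 e0 (ltr0n _ 2))).
    by exists n; rewrite (splitr e) ltrD.
  have n0 : 0 < n.+1%:R^-1 :> R by rewrite invr_gt0.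
  have /fin_all_exists[q qx] (i : 'I_d) : exists q : rat, `|ratr q - x ord0 i| < n.+1%:R^-1.
    have : x ord0 i - n.+1%:R^-1 < x ord0 i + n.+1%:R^-1.
      by rewrite ltrBlDr -addrA ltrDl addr_gt0.
    move=> /rat_in_itvoo[q]; rewrite in_itv/= => qx.
    by exists q; rewrite ltr_distl.
  exists (\row_i q i, n) => [y /= yq|i /=]; last by rewrite mxE.
  apply: eU; split => // i j; rewrite ord1 /ball/=.
  rewrite (le_lt_trans (ler_distD (ratr (q j)) _ _))// (lt_trans _ ne)//.
  rewrite ltrD//; first by rewrite distrC.
  by have := yq j; rewrite mxE.
rewrite bigcup_mkcond; apply: countable_bigcupT_measurable => [|q].
  exact: countableP.
by case: ifP.
Qed.

End measurable_rV.

Definition cons_rV {R : realType} d (z : R * 'rV[R]_d) : 'rV[R]_d.+1 :=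
  \row_i oapp (z.2 ord0) z.1 (unlift ord0 i).

Lemma measurable_cons_rV {R : realType} d :
  measurable_fun [set: R * 'rV[R]_d] (@cons_rV R d).
Proof.
apply: measurable_fun_rV => i.
case: (unliftP ord0 i) => [j|] ->.
  under eq_fun do rewrite mxE liftK /=.
  exact: (measurableT_comp (measurable_coord j)).
under eq_fun do rewrite mxE unlift_none /=.
exact: measurable_fst.
Qed.

HB.instance Definition _ {R : realType} d :=
  isMeasurableFun.Build _ _ _ _ (@cons_rV R d) (@measurable_cons_rV R d).

Section lebesgue_rV_succ.
Context {R : realType} (d : nat).
Variable mu : {sigma_finite_measure set 'rV[R]_d -> \bar R}.

Definition lebesgue_rV_succ : set 'rV[R]_d.+1 -> \bar R :=
  pushforward (lebesgue_measure \x mu)%E (@cons_rV R d).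

Let measurable_preimage_cons A : measurable A -> measurable (@cons_rV R d @^-1` A).
Proof.
by move=> mA; rewrite -[X in measurable X]setTI; exact: measurable_cons_rV.
Qed.

Let succ0 : lebesgue_rV_succ set0 = 0%E.
Proof. by rewrite /lebesgue_rV_succ /pushforward preimage_set0 measure0. Qed.

Let succ_ge0 A : (0 <= lebesgue_rV_succ A)%E.
Proof. exact: (measure_ge0 (lebesgue_measure \x mu)%E). Qed.

Let succ_sigma_additive : semi_sigma_additive lebesgue_rV_succ.
Proof.
move=> F mF tF mUF; rewrite /lebesgue_rV_succ /pushforward preimage_bigcup.
apply: measure_semi_sigma_additive.
- by move=> n; exact: measurable_preimage_cons.
- apply/trivIsetP => /= i j _ _ ij; rewrite -preimage_setI.
  by move/trivIsetP : tF => /(_ _ _ _ _ ij) ->//; rewrite preimage_set0.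
- by rewrite -preimage_bigcup; exact: measurable_preimage_cons.
Qed.

HB.instance Definition _ := isMeasure.Build _ _ _ lebesgue_rV_succ
  succ0 succ_ge0 succ_sigma_additive.

Let succ_sigma_finite : sigma_finite setT lebesgue_rV_succ.
Proof.
have /sigma_finiteP[F [TF ndF Foo]] := sigma_finiteT (@lebesgue_measure R).
have /sigma_finiteP[G [TG ndG Goo]] := sigma_finiteT mu.
pose hd (x : 'rV[R]_d.+1) := x ord0 ord0.
pose tl (x : 'rV[R]_d.+1) := \row_i x ord0 (lift ord0 i).
have mtl : measurable_fun setT tl.
  apply: measurable_fun_rV => i; under eq_fun do rewrite mxE.
  exact: measurable_coord.
exists (fun n => hd @^-1` F n `&` tl @^-1` G n).
  apply/seteqP; split=> // x _.
  have [n _ Fn] : (\bigcup_i F i) (hd x) by rewrite -TF.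
  have [k _ Gk] : (\bigcup_i G i) (tl x) by rewrite -TG.
  exists (maxn n k) => //; split.
    by have /subsetPset := ndF _ _ (leq_maxl n k); apply.
  by have /subsetPset := ndG _ _ (leq_maxr n k); apply.
move=> n; have [mF Fn] := Foo n; have [mG Gn] := Goo n; split.
  apply: measurableI; rewrite -[X in measurable X]setTI.
    exact: measurable_coord.
  exact: mtl.
rewrite /lebesgue_rV_succ /pushforward.
rewrite (_ : _ @^-1` _ = F n `*` G n); last first.
  apply/seteqP; split=> -[t x] /=; rewrite /hd /tl mxE unlift_none/=;
    rewrite (_ : \row_i _ = x)//; by apply/rowP => i; rewrite !mxE liftK.
by rewrite product_measure1E// lte_mul_pinfty// ge0_fin_numE.
Qed.

HB.instance Definition _ :=
  Measure_isSigmaFinite.Build _ _ _ lebesgue_rV_succ succ_sigma_finite.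

End lebesgue_rV_succ.

Fixpoint lebesgue_rV {R : realType} (d : nat) :
    {sigma_finite_measure set 'rV[R]_d -> \bar R} :=
  if d is d'.+1 then lebesgue_rV_succ (lebesgue_rV d') else dirac (0 : 'rV[R]_0).

Lemma measurable_box {R : realType} d (a b : 'rV[R]_d) :
  measurable [set x : 'rV[R]_d | forall i, a ord0 i <= x ord0 i <= b ord0 i].
Proof.
set B := [set x | _].
have -> : B = \big[setI/setT]_(i < d)
    ((fun x : 'rV[R]_d => x ord0 i) @^-1` `[a ord0 i, b ord0 i]).
  rewrite -bigcap_seq; apply/seteqP; split=> [x Bx i _|x Bx i].
    by rewrite /= in_itv/=; exact: Bx.
  by have := Bx i; rewrite /= mem_index_enum in_itv/=; exact.
apply: bigsetI_measurable => i _; rewrite -[X in measurable X]setTI.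
by apply: measurable_coord => //; exact: measurable_itv.
Qed.

Lemma lebesgue_rV_box {R : realType} d (a b : 'rV[R]_d) :
  (forall i, a ord0 i <= b ord0 i) ->
  lebesgue_rV d [set x | forall i, a ord0 i <= x ord0 i <= b ord0 i] =
  (\prod_(i < d) (b ord0 i - a ord0 i))%:E.
Proof.
elim: d a b => [|d IH] a b ab.
  by rewrite big_ord0 /= diracE mem_set// => -[].
pose tl (x : 'rV[R]_d.+1) := \row_i x ord0 (lift ord0 i).
pose B := [set x : 'rV[R]_d | forall i, tl a ord0 i <= x ord0 i <= tl b ord0 i].
rewrite big_ord_recl /= /lebesgue_rV_succ /pushforward.
have -> : @cons_rV R d @^-1` [set x | forall i, a ord0 i <= x ord0 i <= b ord0 i]
    = `[a ord0 ord0, b ord0 ord0]%classic `*` B.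
  apply/seteqP; split=> -[t x] /=.
    move=> h; split=> [|i].
      by have := h ord0; rewrite mxE unlift_none in_itv.
    by have := h (lift ord0 i); rewrite !mxE liftK.
  rewrite in_itv/= => -[ht hx] i; rewrite mxE.
  case: (unliftP ord0 i) => [j|] -> /=.
    by have := hx j; rewrite !mxE.
  by [].
have mB : measurable B by exact: measurable_box.
rewrite product_measure1E//= IH => [|i]; last by rewrite !mxE.
rewrite lebesgue_measure_itv/= EFinM; congr (_ * _)%E.
  rewrite lte_fin; case: ltP => [_|ba]; first by rewrite EFinB.
  by rewrite (@le_anti _ _ (a ord0 ord0) (b ord0 ord0)) ?ab ?ba// subrr.
by congr EFin; apply: eq_bigr => i _; rewrite !mxE.
Qed.

Section L2_functions.
Context d (T : measurableType d) (R : realType).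
Variable mu : {measure set T -> \bar R}.
Implicit Types f g : T -> R[i].

Definition cmeasurable f :=
  measurable_fun setT (fun x => complex.Re (f x)) /\
  measurable_fun setT (fun x => complex.Im (f x)).

Definition L2norm f : \bar R := Lnorm mu 2%:E (fun x => (normc (f x))%:E).

Definition finL2 f := cmeasurable f /\ (L2norm f < +oo)%E.

Lemma measurable_normc f : cmeasurable f ->
  measurable_fun setT (fun x => normc (f x)).
Proof.
case=> mRe mIm.
rewrite (_ : (fun _ => _) =
    (fun x => Num.sqrt (complex.Re (f x) ^+ 2 + complex.Im (f x) ^+ 2))); last first.
  by apply/funext => x; case: (f x).
apply: (@measurableT_comp _ _ _ _ _ _ (@Num.sqrt R)).
  exact: (continuous_measurable_fun (@sqrt_continuous R)).
by apply: measurable_funD; exact: measurable_funX.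
Qed.

Lemma normc_ge0 (z : R[i]) : 0 <= normc z.
Proof. by case: z => a b; exact: sqrtr_ge0. Qed.

Lemma L2norm_ge0 f : (0 <= L2norm f)%E.
Proof. exact: Lnorm_ge0. Qed.

Lemma L2normE f :
  L2norm f = ((\int[mu]_x (normc (f x) `^ 2)%:E) `^ 2^-1)%E.
Proof.
rewrite /L2norm unlock; congr (_ `^ _)%E; apply: eq_integral => x _.
by rewrite /= ger0_norm// normc_ge0.
Qed.

Lemma cmeasurable0 : cmeasurable (fun=> 0).
Proof. by split; exact: measurable_cst. Qed.

Lemma cmeasurableD f g : cmeasurable f -> cmeasurable g ->
  cmeasurable (fun x => f x + g x).
Proof.
move=> [mf1 mf2] [mg1 mg2]; split.
  rewrite (_ : (fun _ => _) = (fun x => complex.Re (f x) + complex.Re (g x))).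
    exact: measurable_funD.
  by apply/funext => x; case: (f x); case: (g x).
rewrite (_ : (fun _ => _) = (fun x => complex.Im (f x) + complex.Im (g x))).
  exact: measurable_funD.
by apply/funext => x; case: (f x); case: (g x).
Qed.

Lemma cmeasurableM (a : R[i]) f : cmeasurable f ->
  cmeasurable (fun x => a * f x).
Proof.
case: a => a b [mf1 mf2]; split.
  rewrite (_ : (fun _ => _) = (fun x => a * complex.Re (f x) - b * complex.Im (f x))).
    by apply: measurable_funB; exact: measurable_funM.
  by apply/funext => x; case: (f x).
rewrite (_ : (fun _ => _) = (fun x => a * complex.Im (f x) + b * complex.Re (f x))).
  by apply: measurable_funD; exact: measurable_funM.
by apply/funext => x; case: (f x).
Qed.

Lemma L2norm0 : L2norm (fun=> 0) = 0%E.
Proof. by rewrite /L2norm; under eq_Lnorm do rewrite normc0; rewrite Lnorm0. Qed.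

Lemma L2normD f g : cmeasurable f -> cmeasurable g ->
  (L2norm (fun x => f x + g x)%R <= L2norm f + L2norm g)%E.
Proof.
move=> mf mg.
have mnf := measurable_normc mf; have mng := measurable_normc mg.
apply: le_trans (eminkowski _ mnf mng _); last by rewrite lee1n.
rewrite L2normE unlock; apply: gt0_ler_poweR; rewrite ?invr_ge0//.
- by rewrite in_itv/= leey integral_ge0// => x _; rewrite lee_fin powR_ge0.
- by rewrite in_itv/= leey integral_ge0// => x _; rewrite poweR_ge0.
apply: ge0_le_integral => //.
- by move=> x _; rewrite lee_fin powR_ge0.
- apply/measurable_EFinP/(measurableT_comp (measurable_powR _)).
  exact/measurable_normc/cmeasurableD.
- apply/measurable_EFinP/(measurableT_comp (measurable_powR _)).
  exact/measurableT_comp/measurable_funD.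
- move=> x _; rewrite lee_fin ge0_ler_powR ?nnegrE ?normc_ge0//.
  by rewrite (le_trans (le_normcD _ _))// ler_norm.
Qed.

Lemma L2normM (a : R[i]) f : cmeasurable f ->
  (L2norm (fun x => a * f x)%R = (normc a)%:E * L2norm f)%E.
Proof.
move=> mf; rewrite !L2normE.
under eq_integral do rewrite normcM powRM ?normc_ge0// EFinM.
rewrite ge0_integralZl_EFin ?powR_ge0//; last 2 first.
- by move=> x _; rewrite lee_fin powR_ge0.
- apply/measurable_EFinP/(measurableT_comp (measurable_powR _)).
  exact: measurable_normc.
rewrite poweRM ?integral_ge0 ?lee_fin ?powR_ge0//; last first.
  by move=> x _; rewrite lee_fin powR_ge0.
by rewrite poweR_EFin -powRrM mulfV// powRr1// normc_ge0.
Qed.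

Lemma L2norm_eq0 f : cmeasurable f -> L2norm f = 0%E ->
  {ae mu, forall x, f x = 0}.
Proof.
move=> mf f0.
have /measurable_EFinP mn := measurable_normc mf.
have := Lnorm_eq0_eq0 mn (lte0n 2) f0.
by apply: filterS => x /(_ I) [] /eq0_normc.
Qed.

Lemma eq_L2norm_ae f g : cmeasurable f -> cmeasurable g ->
  {ae mu, forall x, f x = g x} -> L2norm f = L2norm g.
Proof.
move=> mf mg fg; rewrite !L2normE; congr (_ `^ _)%E.
apply: ge0_ae_eq_integral => //.
- apply/measurable_EFinP/(measurableT_comp (measurable_powR _)).
  exact: measurable_normc.
- apply/measurable_EFinP/(measurableT_comp (measurable_powR _)).
  exact: measurable_normc.
- by move=> x _; rewrite lee_fin powR_ge0.
- by move=> x _; rewrite lee_fin powR_ge0.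
- by apply: filterS fg => x /= -> _.
Qed.

End L2_functions.
Section L2_space.
Context d (T : measurableType d) (R : realType).
Variable mu : {measure set T -> \bar R}.

Record L2fun := MkL2fun {
  L2fun_val :> T -> R[i];
  L2fun_fin : finL2 mu L2fun_val }.

HB.instance Definition _ := gen_eqMixin L2fun.
HB.instance Definition _ := gen_choiceMixin L2fun.

Definition L2fun_eq (f g : L2fun) : bool :=
  `[< {ae mu, forall x, f x = g x} >].

Let L2fun_eq_refl : reflexive L2fun_eq.
Proof. by move=> f; apply/asboolP/nearW. Qed.

Let L2fun_eq_sym : symmetric L2fun_eq.
Proof.
by move=> f g; apply/asboolP/asboolP; apply: filterS => x ->.
Qed.

Let L2fun_eq_trans : transitive L2fun_eq.
Proof.
move=> g f h /asboolP fg /asboolP gh; apply/asboolP.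
by apply: filterS2 fg gh => x -> ->.
Qed.

Canonical L2fun_equiv :=
  EquivRel L2fun_eq L2fun_eq_refl L2fun_eq_sym L2fun_eq_trans.

Local Open Scope quotient_scope.

Definition L2 : Type := {eq_quot L2fun_eq}.
HB.instance Definition _ := Choice.on L2.
HB.instance Definition _ := EqQuotient.on L2.

Definition L2_repr (u : L2) : T -> R[i] := repr u.
Coercion L2_repr : L2 >-> Funclass.

Definition L2_class (f : L2fun) : L2 := \pi_L2 f.

Lemma L2_classE (f : L2fun) : {ae mu, forall x, L2_class f x = f x}.
Proof.
by apply/asboolP; rewrite -/(L2fun_eq _ _) -eqmodE; apply/eqP; rewrite reprK.
Qed.

Lemma L2P (u v : L2) : {ae mu, forall x, u x = v x} -> u = v.
Proof.
by move=> uv; rewrite -(reprK u) -(reprK v); apply/eqmodP/asboolP.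
Qed.

Lemma L2_fin (u : L2) : finL2 mu u.
Proof. exact: L2fun_fin. Qed.

Let aeS (P Q : T -> Prop) : {ae mu, forall x, P x -> Q x} ->
  {ae mu, forall x, P x} -> {ae mu, forall x, Q x}.
Proof. by move=> PQ Pm; apply: filterS2 PQ Pm => x; apply. Qed.

Let ae_all (P : T -> Prop) : (forall x, P x) -> {ae mu, forall x, P x}.
Proof. exact: nearW. Qed.

Let zero_fin : finL2 mu (fun=> 0).
Proof. by split; [exact: cmeasurable0|rewrite L2norm0]. Qed.

Let add_fin (u v : L2) : finL2 mu (fun x => u x + v x).
Proof.
have [mu_ fu] := L2_fin u; have [mv fv] := L2_fin v; split.
  exact: cmeasurableD.
by rewrite (le_lt_trans (L2normD _ _ _))// lte_add_pinfty.
Qed.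

Let scale_fin (a : R[i]) (u : L2) : finL2 mu (fun x => a * u x).
Proof.
have [mu_ fu] := L2_fin u; split; first exact: cmeasurableM.
by rewrite L2normM// lte_mul_pinfty// lee_fin normc_ge0.
Qed.

Let zero : L2 := L2_class (MkL2fun zero_fin).
Let add u v : L2 := L2_class (MkL2fun (add_fin u v)).
Let scale a u : L2 := L2_class (MkL2fun (scale_fin a u)).
Let opp u : L2 := scale (-1) u.

Let zeroE : {ae mu, forall x, zero x = 0}.
Proof. exact: L2_classE. Qed.
Let addE u v : {ae mu, forall x, add u v x = u x + v x}.
Proof. exact: L2_classE. Qed.
Let scaleE a u : {ae mu, forall x, scale a u x = a * u x}.
Proof. exact: L2_classE. Qed.

Let addA : associative add.
Proof.
move=> u v w; apply: L2P.
apply: aeS (addE u (add v w)); apply: aeS (addE v w).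
apply: aeS (addE (add u v) w); apply: aeS (addE u v).
by apply: ae_all => x e1 -> e2 ->; rewrite e1 e2 addrA.
Qed.

Let addC : commutative add.
Proof.
move=> u v; apply: L2P.
by apply: filterS2 (addE u v) (addE v u) => x -> ->; rewrite addrC.
Qed.

Let add0 : left_id zero add.
Proof.
move=> u; apply: L2P.
by apply: filterS2 zeroE (addE zero u) => x z ->; rewrite z add0r.
Qed.

Let addN : left_inverse zero opp add.
Proof.
move=> u; apply: L2P.
apply: filterS3 zeroE (addE (opp u) u) (scaleE (-1) u) => x -> ->.
by rewrite /opp => ->; rewrite mulN1r addNr.
Qed.

HB.instance Definition _ := GRing.isZmodule.Build L2 addA addC add0 addN.

Let scaleA a b u : scale a (scale b u) = scale (a * b) u.
Proof.
apply: L2P.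
apply: filterS3 (scaleE a (scale b u)) (scaleE b u) (scaleE (a * b) u).
by move=> x -> -> ->; rewrite mulrA.
Qed.

Let scale1 : left_id 1 scale.
Proof.
by move=> u; apply: L2P; apply: filterS (scaleE 1 u) => x ->; rewrite mul1r.
Qed.

Let scaleDr : right_distributive scale +%R.
Proof.
move=> a u v; apply: L2P.
apply: aeS (scaleE a (add u v)); apply: aeS (addE u v).
apply: aeS (addE (scale a u) (scale a v)).
apply: aeS (scaleE a u); apply: aeS (scaleE a v).
by apply: ae_all => x e1 e2 -> e3 ->; rewrite e1 e2 e3 mulrDr.
Qed.

Let scaleDl u : {morph scale^~ u : a b / a + b}.
Proof.
move=> a b; apply: L2P.
apply: aeS (scaleE (a + b) u).
apply: aeS (addE (scale a u) (scale b u)).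
apply: aeS (scaleE a u); apply: aeS (scaleE b u).
by apply: ae_all => x e1 e2 -> ->; rewrite e1 e2 mulrDl.
Qed.

HB.instance Definition _ :=
  GRing.Zmodule_isLmodule.Build R[i] L2 scaleA scale1 scaleDr scaleDl.

Lemma L2_0E : {ae mu, forall x, (0 : L2) x = 0}.
Proof. exact: zeroE. Qed.

Lemma L2_addE (u v : L2) : {ae mu, forall x, (u + v : L2) x = u x + v x}.
Proof. exact: addE. Qed.

Lemma L2_scaleE (a : R[i]) (u : L2) : {ae mu, forall x, (a *: u : L2) x = a * u x}.
Proof. exact: scaleE. Qed.

(* A normed module over the complex field has its norm valued in that field,
   hence the embedding of the real number ||u||_2. *)
Let norm (u : L2) : R[i] := (fine (L2norm mu u))%:C.

Let normK (u : L2) : (fine (L2norm mu u))%:E = L2norm mu u.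
Proof.
by rewrite fineK// ge0_fin_numE ?L2norm_ge0//; have [] := L2_fin u.
Qed.

Let normD (u v : L2) : norm (u + v) <= norm u + norm v.
Proof.
rewrite /norm -rmorphD lecR -lee_fin EFinD !normK.
have [[mu1 _] [mv _] [muv _]] := And3 (L2_fin u) (L2_fin v) (L2_fin (u + v)).
rewrite (eq_L2norm_ae muv (cmeasurableD mu1 mv) (L2_addE u v)).
exact: L2normD.
Qed.

Let normZ (a : R[i]) (u : L2) : norm (a *: u) = `|a| * norm u.
Proof.
have [[mu1 _] [mau _]] := conj (L2_fin u) (L2_fin (a *: u)).
rewrite /norm (eq_L2norm_ae mau (cmeasurableM a mu1) (L2_scaleE a u)).
by rewrite L2normM// fineM ?rmorphM//= -normK.
Qed.

Let norm_eq0 (u : L2) : norm u = 0 -> u = 0.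
Proof.
move=> [u0]; apply: L2P.
have {}u0 : L2norm mu u = 0%E by rewrite -normK u0.
have [mu1 _] := L2_fin u.
by apply: filterS2 L2_0E (L2norm_eq0 mu1 u0) => x -> ->.
Qed.

HB.instance Definition _ :=
  Lmodule_isNormed.Build R[i] L2 normD normZ norm_eq0.

Lemma L2_normE (u : L2) : `|u| = (fine (L2norm mu u))%:C.
Proof. by []. Qed.

(* The class of f when f is square-integrable, and 0 otherwise. *)
Definition toL2 (f : T -> R[i]) : L2 :=
  if pselect (finL2 mu f) is left fL2 then L2_class (MkL2fun fL2) else 0.

Lemma toL2E (f : T -> R[i]) : finL2 mu f -> {ae mu, forall x, toL2 f x = f x}.
Proof. by move=> fL2; rewrite /toL2; case: pselect => // h; exact: L2_classE. Qed.

End L2_space.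

Section operators_and_semigroups.
Context {R : realType} {V : normedModType R[i]}.

(* A linear operator is given by its domain D and a total function A of which
   only the restriction to D matters. *)
Definition linear_operator (D : set V) (A : V -> V) :=
  D 0 /\
  forall (a : R[i]) (u v : V), D u -> D v ->
    D (a *: u + v) /\ A (a *: u + v) = a *: A u + A v.

Definition closed_operator (D : set V) (A : V -> V) :=
  closed [set z : V * V | D z.1 /\ z.2 = A z.1].

(* Only the values S t for t >= 0 matter. *)
Definition C0_semigroup (S : R -> V -> V) :=
  [/\ forall t, 0 <= t -> linear (S t) /\ continuous (S t),
      forall u, S 0 u = u,
      forall s t u, 0 <= s -> 0 <= t -> S (s + t) u = S s (S t u)
    & forall u, S t u @[t --> 0^'+] --> u].

Definition infinitesimal_generator (S : R -> V -> V) (D : set V) (A : V -> V) :=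
  forall u v, (D u /\ v = A u) <->
    ((h^-1)%:C *: (S h u - u)) @[h --> 0^'+] --> v.

(* x 0 <= ... <= x n is a partition of [a, b] with tags xi. *)
Definition tagged_partition (a b : R) (n : nat) (x xi : nat -> R) :=
  [/\ x 0%N = a, x n = b & forall i, (i < n)%N -> x i <= xi i <= x i.+1].

Definition is_Riemann_integral (F : R -> V) (a b : R) (I : V) :=
  forall e : R, 0 < e -> exists2 delta : R, 0 < delta &
    forall n x xi, tagged_partition a b n x xi ->
      (forall i, (i < n)%N -> x i.+1 - x i < delta) ->
      `|\sum_(i < n) (x i.+1 - x i)%:C *: F (xi i) - I| < e%:C.

(* The integrand s |-> S (t - s) (F s) is continuous on [0, t] when S is
   strongly continuous and F is continuous, so its integral is a vector-valued
   Riemann integral. *)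
Definition mild_solution (S : R -> V -> V) (u0 : V) (F w : R -> V) :=
  forall t, 0 <= t ->
    exists2 I, is_Riemann_integral (fun s => S (t - s) (F s)) 0 t I &
      w t = S t u0 + I.

End operators_and_semigroups.

Section smooth_functions.
Context {R : realType} {V : normedModType R}.

(* All iterated directional derivatives exist and are continuous on U, which is
   meant to be open. *)
Definition smooth_on (U : set V) (g : V -> R) :=
  forall s : seq V,
    let h := foldr (fun v h => 'D_v h) g s in
    forall x, U x -> {for x, continuous h} /\ forall v, derivable h x v.

Definition csmooth_on (U : set V) (g : V -> R[i]) :=
  smooth_on U (fun x => complex.Re (g x)) /\
  smooth_on U (fun x => complex.Im (g x)).

Definition support_in (U : set V) (g : V -> R[i]) : set V :=
  U `&` closure (U `&` [set x | g x <> 0]).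

(* C_c^oo(U), as functions on V vanishing outside U. *)
Definition test_function (U : set V) (g : V -> R[i]) :=
  [/\ csmooth_on U g, compact (closure [set x | g x <> 0])
    & closure [set x | g x <> 0] `<=` U].

End smooth_functions.

Section complex_integral.
Context d (T : measurableType d) (R : realType).
Variables (mu : {measure set T -> \bar R}) (D : set T).
Implicit Types f : T -> R[i].

Definition cintegrable f :=
  mu.-integrable D (fun x => (complex.Re (f x))%:E) /\
  mu.-integrable D (fun x => (complex.Im (f x))%:E).

Definition cintegral f : R[i] :=
  (\int[mu]_(x in D) complex.Re (f x)) +i* (\int[mu]_(x in D) complex.Im (f x)).

Definition L2norm_on f : \bar R :=
  ((\int[mu]_(x in D) (normc (f x) ^+ 2)%:E) `^ 2^-1)%E.

End complex_integral.

Section fundamental_solutions.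
Context {R : realType} {d : nat}.
Notation E := ('rV[R]_d).
Variable Omega : set E.

Definition time_space : set (R * E) := `]0, +oo[%classic `*` Omega.

Definition time_space2 : set (R * E * E) := time_space `*` Omega.

Variable p : R * E * E -> R[i].

Definition initial_term (w0 : E -> R[i]) (t : R) (x : E) : R[i] :=
  cintegral (lebesgue_rV d) Omega (fun y => p (t, x, y) * w0 y).

Definition source_integrand (f : R * E -> R[i]) (t : R) (x : E) (s : R) : R[i] :=
  cintegral (lebesgue_rV d) Omega (fun y => p (t - s, x, y) * f (s, y)).

Definition source_term (f : R * E -> R[i]) (t : R) (x : E) : R[i] :=
  cintegral lebesgue_measure `]0, t[ (source_integrand f t x).

(* Since cintegral is total, convergence is recorded separately. *)
Definition integrals_converge (w0 : E -> R[i]) (f : R * E -> R[i]) (t : R) (x : E) :=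
  [/\ cintegrable (lebesgue_rV d) Omega (fun y => p (t, x, y) * w0 y),
      forall s, 0 < s < t ->
        cintegrable (lebesgue_rV d) Omega (fun y => p (t - s, x, y) * f (s, y))
    & cintegrable lebesgue_measure `]0, t[ (source_integrand f t x)].

(* w is represented by the kernel p; w t is an L^2 class, so that the identity is
   for almost every x. *)
Definition represented (w0 : E -> R[i]) (f : R * E -> R[i]) (w : R -> E -> R[i]) :=
  forall t, 0 < t -> {ae lebesgue_rV d, forall x, Omega x ->
    integrals_converge w0 f t x /\
    w t x = initial_term w0 t x + source_term f t x}.

End fundamental_solutions.

Definition lebesgue_on {R : realType} {d : nat} (Omega : set 'rV[R]_d)
    (oOmega : open Omega) : {measure set 'rV[R]_d -> \bar R} :=
  mrestr (lebesgue_rV d) (open_measurable_rV oOmega).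

(* The next lemmas show that toL2 is applied to square-integrable functions in
   fundamental_solution below. *)
Section test_functions_L2.
Context {R : realType} {d : nat}.
Variables (Omega : set 'rV[R]_d) (oOmega : open Omega).

Lemma continuous_measurable_rV (h : 'rV[R]_d -> R) :
  continuous h -> measurable_fun setT h.
Proof.
move=> /continuousP ch; apply: (measurability _ (RGenOpens.measurableE R)).
move=> _ [_ [a [b ->] <-]]; rewrite setTI; apply: open_measurable_rV.
exact/ch/interval_open.
Qed.

Lemma continuous_compact_finL2 (g : 'rV[R]_d -> R[i]) (K : set 'rV[R]_d) :
  continuous (fun x => complex.Re (g x)) ->
  continuous (fun x => complex.Im (g x)) ->
  compact K -> (forall x, ~ K x -> g x = 0) -> finL2 (lebesgue_on oOmega) g.
Proof.
move=> cRe cIm cK gK.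
have mg : cmeasurable g by split; exact: continuous_measurable_rV.
split=> //; rewrite L2normE poweR_lty//.
have bnd (V : normedModType R) (A : set V) :
    compact A -> exists2 M, 0 < M & forall x, A x -> `|x| <= M.
  by move=> /compact_bounded/pinfty_ex_gt0[M M0 AM]; exists M.
have [M1 M10 hM1] := bnd _ _ (continuous_compact (continuous_subspaceT cRe) cK).
have [M2 M20 hM2] := bnd _ _ (continuous_compact (continuous_subspaceT cIm) cK).
have [N N0 hN] := bnd _ _ cK.
pose B := [set x : 'rV[R]_d |
  forall i, (const_mx (- N) : 'rV[R]_d) ord0 i <= x ord0 i <=
            (const_mx N : 'rV[R]_d) ord0 i].
have KB : K `<=` B.
  move=> x Kx i; rewrite !mxE -ler_norml (le_trans _ (hN _ Kx))//.
  by rewrite [leRHS]mx_normrE (le_bigmax _ (fun j => `|x j.1 j.2|) (ord0, i)).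
have mB : measurable B by exact: measurable_box.
pose M := (M1 ^+ 2 + M2 ^+ 2).
have hM x : normc (g x) `^ 2 <= M * \1_B x.
  rewrite powR_mulrn ?normc_ge0//.
  have [Kx|nKx] := pselect (K x); last first.
    by rewrite gK// normc0 expr0n mulr_ge0 ?addr_ge0 ?sqr_ge0.
  rewrite indicE mem_set ?mulr1; last exact: KB.
  rewrite (_ : normc _ ^+ 2 = complex.Re (g x) ^+ 2 + complex.Im (g x) ^+ 2).
    have sq (a b : R) : 0 < b -> `|a| <= b -> a ^+ 2 <= b ^+ 2.
      move=> b0 ab; rewrite -[leLHS]real_normK ?num_real//.
      by rewrite ler_pXn2r ?nnegrE// ltW.
    by apply: lerD; apply: sq => //; [apply: hM1|apply: hM2]; exists x.
  by case: (g x) => a b; rewrite sqr_sqrtr ?addr_ge0 ?sqr_ge0.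
apply: (@le_lt_trans _ _ (\int[lebesgue_on oOmega]_x (M * \1_B x)%:E)%E).
  apply: ge0_le_integral => //.
  - by move=> x _; rewrite lee_fin powR_ge0.
  - apply/measurable_EFinP/(measurableT_comp (measurable_powR _)).
    exact: measurable_normc.
  - apply/measurable_EFinP/measurable_funM => //.
  - by move=> x _; rewrite lee_fin.
under eq_integral do rewrite EFinM.
rewrite ge0_integralZl_EFin ?addr_ge0 ?sqr_ge0//; last exact/measurable_EFinP.
rewrite lte_mul_pinfty ?lee_fin ?addr_ge0 ?sqr_ge0// integral_indic// setIT.
apply: (@le_lt_trans _ _ (lebesgue_rV d B)).
  by apply: le_measure; rewrite ?inE//; apply: measurableI => //; exact: open_measurable_rV.
rewrite lebesgue_rV_box ?ltry// => i; rewrite !mxE.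
by rewrite (le_trans (y := 0)) ?oppr_le0 ?ltW.
Qed.

Lemma test_function_continuous (V : normedModType R) (U : set V) (g : V -> R[i]) :
  open U -> test_function U g ->
  continuous (fun x => complex.Re (g x)) /\ continuous (fun x => complex.Im (g x)).
Proof.
move=> oU [[sRe sIm] _ KU].
have near0 x : ~ U x -> \forall y \near x, g y = 0.
  move=> nUx; pose A := ~` closure [set x | g x <> 0].
  have : nbhs x A.
    apply: open_nbhs_nbhs; split; first exact/closed_openC/closed_closure.
    by move=> /KU.
  apply: filterS => y Ay; apply: contrapT => gy; apply: Ay.
  exact: subset_closure.
have key (c : R[i] -> R) : smooth_on U (fun x => c (g x)) ->
    continuous (fun x => c (g x)).
  move=> sc x; have [Ux|nUx] := pselect (U x); first by have [] := sc [::] x Ux.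
  rewrite /continuous_at (nbhs_singleton (near0 x nUx)).
  by apply: cvg_near_cst; apply: filterS (near0 x nUx) => y ->.
by split; exact: key.
Qed.

Lemma open_time_space : open Omega -> open (time_space Omega).
Proof.
move=> oO; rewrite openE => -[t x] [/= t0 Ox].
exists (`]0, +oo[%classic, Omega) => //=; split.
  by apply: open_nbhs_nbhs; split => //; exact: interval_open.
exact: open_nbhs_nbhs.
Qed.

Lemma test_function_finL2 (g : 'rV[R]_d -> R[i]) :
  test_function Omega g -> finL2 (lebesgue_on oOmega) g.
Proof.
move=> tg; have [cRe cIm] := test_function_continuous oOmega tg.
have [_ cK _] := tg; apply: continuous_compact_finL2 cRe cIm cK _ => x nKx.
by apply: contrapT => gx; apply: nKx; exact: subset_closure.
Qed.

Lemma test_function_slice_finL2 (f : R * 'rV[R]_d -> R[i]) (s : R) :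
  test_function (time_space Omega) f ->
  finL2 (lebesgue_on oOmega) (fun y => f (s, y)).
Proof.
move=> tf.
have [cRe cIm] := test_function_continuous (open_time_space oOmega) tf.
have [_ cK _] := tf.
have cs : continuous (fun y : 'rV[R]_d => (s, y)).
  move=> y A [[A1 A2] /= [A1s A2y] sA]; apply: filterS A2y => z A2z.
  by apply: (sA (s, z)); split => //=; exact: nbhs_singleton.
pose K := closure [set z : R * 'rV[R]_d | f z <> 0].
have cK2 : compact (snd @` K).
  by apply: continuous_compact => //; apply: continuous_subspaceT => z; exact: cvg_snd.
apply: (@continuous_compact_finL2 _ (snd @` K)) => //.
- by move=> y; exact: (continuous_comp (cs y) (cRe _)).
- by move=> y; exact: (continuous_comp (cs y) (cIm _)).
- move=> y nKy; apply: contrapT => fy; apply: nKy.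
  by exists (s, y) => //; exact: subset_closure.
Qed.

End test_functions_L2.

Definition fundamental_solution {R : realType} {d : nat} (Omega : set 'rV[R]_d)
    (oOmega : open Omega)
    (S : R -> L2 (lebesgue_on oOmega) -> L2 (lebesgue_on oOmega))
    (p : R * 'rV[R]_d * 'rV[R]_d -> R[i]) :=
  csmooth_on (time_space2 Omega) p /\
  forall w0 f, test_function Omega w0 -> test_function (time_space Omega) f ->
    exists2 w : R -> L2 (lebesgue_on oOmega),
      mild_solution S (toL2 _ w0) (fun s => toL2 _ (fun y => f (s, y))) w &
      represented Omega p w0 f w.

Definition weight {R : realType} {d : nat} (phi a : 'rV[R]_d -> R)
    (g : R * 'rV[R]_d -> R[i]) (z : R * 'rV[R]_d) : R[i] :=
  (expR (z.1 * phi z.2) * a z.2)%:C * g z.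

Definition weighted_norm {R : realType} {d : nat} (Omega : set 'rV[R]_d)
    (phi a : 'rV[R]_d -> R) (g : R * 'rV[R]_d -> R[i]) : \bar R :=
  L2norm_on (lebesgue_measure \x lebesgue_rV d)%E (time_space Omega)
    (weight phi a g).

(* Main.v *)
Require Import Defs.
From HB Require Import structures.
From mathcomp Require Import all_boot all_order all_algebra.
From mathcomp Require Import all_classical all_reals all_analysis measurable_realfun.
From mathcomp Require Import complex ring lra.
Import Order.TTheory GRing.Theory Num.Theory.
Import numFieldNormedType.Exports ComplexField.Normc.
Local Open Scope classical_set_scope.
Local Open Scope complex_scope.
Local Open Scope ring_scope.

(** Choose [x0], [y0] with [phi y0 < phi x0]. As [p] has full support, it does not
    vanish at some [(tau, x, y)] with [(x, y)] close to [(x0, y0)]. Let the source be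
    a bump in space-time located at [(n, y)], times a constant which makes the real
    part of [p] times the source nonnegative. At times near [n + tau] and points near
    [x], the real part of the solution is then bounded below independently of [n].
    Hence the weighted norm of the solution grows at least like [exp (n * alpha)] and
    that of the source at most like [exp (n * beta)], where
    [phi y < beta < alpha < phi x]. *)

(** * Smooth functions built from exp(-1/x) *)

(** The classical function exp(-1/x), extended by 0 to x <= 0, is [flat 0]. The factor x^-k is there
    because differentiation produces such powers. *)
Definition flat {R : realType} (k : nat) (x : R) : R :=
  if 0 < x then x^-1 ^+ k * expR (- x^-1) else 0.

Lemma flat_ge0 {R : realType} k (x : R) : 0 <= flat k x.
Proof.
rewrite /flat; case: ifPn => // x0.
by rewrite mulr_ge0 ?expR_ge0// exprn_ge0// invr_ge0 ltW.
Qed.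

(** With u = 1/x, the exponential series gives exp u >= u^(k+2) / (k+2)!, hence u^k exp(-u) <=
    (k+2)! u^-2. This quadratic bound gives the derivative at 0. *)
Lemma flat_le_sqr {R : realType} k (x : R) : flat k x <= k.+2`!%:R * x ^+ 2.
Proof.
rewrite /flat; case: ifPn => x0; last by rewrite mulr_ge0 ?sqr_ge0.
have u0 : 0 < x^-1 by rewrite invr_gt0.
have H : x^-1 ^+ k.+2 / k.+2`!%:R <= expR x^-1.
  by apply: le_trans (expR_ge1Dxn k.+1 (ltW u0)); rewrite lerDr.
rewrite expRN ler_pdivrMr ?expR_gt0//.
rewrite ler_pdivrMr ?ltr0n ?fact_gt0// in H.
rewrite mulrC mulrA -ler_pdivrMr; last by rewrite exprn_gt0.
by rewrite -exprVn -exprD addn2.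
Qed.

Lemma is_derive_flat {R : realType} k (x : R) :
  is_derive x 1 (flat k) (- k%:R * flat k.+1 x + flat k.+2 x).
Proof.
case: (ltgtP x 0) => [x0|x0|->].
- rewrite /flat ltNge ltW//= mulr0 addr0.
  apply: (@near_eq_is_derive _ _ _ (cst 0)).
  near=> y; rewrite /= ltNge ltW//=; near: y.
  exact: lt_nbhsl.
- rewrite {2 3}/flat x0.
  have xn0 : x != 0 by rewrite gt_eqF.
  apply: (@near_eq_is_derive _ _ _ ((fun y => y^-1) ^+ k * (expR \o (fun y => - y^-1)))).
  + near=> y; rewrite /flat ifT; last by near: y; exact: lt_nbhsr.
    by rewrite /GRing.mul/= exprfctE.
  + have dV : is_derive x 1 (fun y : R => y^-1) (- x ^- 2).
      have := @is_deriveV R id x 1 1 xn0 (is_derive_id _ _).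
      by rewrite /= /GRing.scale/= mulr1.
    have dE : is_derive x 1 (expR \o (fun y => - y^-1)) (expR (- x^-1) * x ^- 2).
      have H : is_derive x 1 (fun y : R => - y^-1) (x ^- 2).
        by have := is_deriveN dV; rewrite opprK.
      exact: is_derive1_comp.
    apply: is_derive_eq (is_deriveM (is_deriveX k dV) dE) _.
    rewrite /GRing.scale/= exprfctE -exprVn.
    set u := x^-1; set e := expR _; case: k => [|k] /=.
      by rewrite !mul0r oppr0 !mul0r mulr0 addr0 add0r expr0 mul1r mulrC.
    rewrite !exprS expr0; ring.
- rewrite /flat ltxx mulr0 addr0.
  (* By the quadratic bound the difference quotient at 0 is at most (k+2)! |h| in absolute value. *)
  have c0 : h^-1 *: ((flat k \o shift 0) (h *: 1) - flat k 0) @[h --> 0^'] --> (0 : R).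
    apply: (@cvg_to_0_linear _ _ k.+2`!%:R 1) => // h /andP[h0 _].
    rewrite /= addr0 /GRing.scale/= mulr1 [flat k 0]/flat ltxx subr0.
    rewrite normrM normfV (ger0_norm (flat_ge0 _ _)) mulrC ler_pdivrMr//.
    by rewrite -mulrA -expr2 real_normK ?num_real// flat_le_sqr.
  by apply: DeriveDef; [apply/cvg_ex; exists 0|exact/cvg_lim].
Unshelve. all: end_near.
Qed.

Lemma flat_continuous {R : realType} k : continuous (@flat R k).
Proof.
move=> x; apply: differentiable_continuous; apply/derivable1_diffP.
by case: (is_derive_flat k x).
Qed.

(* Closed under directional derivatives, since [flat k]' is a linear combination
   of [flat k.+1] and [flat k.+2]. *)
Inductive flat_algebra {R : realType} {V : normedModType R} : (V -> R) -> Prop :=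
| flat_algebra_cst (c : R) : flat_algebra (fun=> c)
| flat_algebra_flat k (l : V -> R) (c : R) :
    (forall (a : R) u v, l (a *: u + v) = a * l u + l v) -> continuous l ->
    flat_algebra (fun x => flat k (l x + c))
| flat_algebraD f g :
    flat_algebra f -> flat_algebra g -> flat_algebra (fun x => f x + g x)
| flat_algebraM f g :
    flat_algebra f -> flat_algebra g -> flat_algebra (fun x => f x * g x).

Lemma flat_algebra_continuous {R : realType} {V : normedModType R} (f : V -> R) :
  flat_algebra f -> continuous f.
Proof.
elim=> {f} [c|k l c lin cl|f g _ cf _ cg|f g _ cf _ cg] x.
- exact: cvg_cst.
- apply: (@continuous_comp _ _ _ (fun x => l x + c) (flat k)).
    by apply: cvgD; [exact: cl|exact: cvg_cst].
  exact: flat_continuous.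
- by apply: cvgD; [exact: cf|exact: cg].
- by apply: cvgM; [exact: cf|exact: cg].
Qed.

(** By linearity of [l], the difference quotient along [v] is that of [flat k] at [l x + c] in the
    real direction [l v]; the differential then lets [l v] factor out. *)
Lemma is_derive_flat_comp {R : realType} {V : normedModType R} k (l : V -> R)
    (c : R) (x v : V) :
  (forall (a : R) u v, l (a *: u + v) = a * l u + l v) ->
  is_derive x v (fun x => flat k (l x + c))
    (l v * (- k%:R * flat k.+1 (l x + c) + flat k.+2 (l x + c))).
Proof.
move=> lin; set y := l x + c.
have dk := is_derive_flat k y; have df : differentiable (flat k) y.
  by apply/derivable1_diffP; case: dk.
have quot (h : R) : h^-1 *: (((fun x => flat k (l x + c)) \o shift x) (h *: v)
    - flat k (l x + c)) =
    h^-1 *: ((flat k \o shift y) (h *: (l v)) - flat k y).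
  by rewrite /= lin -/y /GRing.scale/= addrA.
have dlv : derivable (flat k) y (l v) by exact: diff_derivable.
apply: DeriveDef.
  by rewrite /derivable; under eq_fun do rewrite quot.
rewrite /derive; under eq_fun do rewrite quot.
rewrite -/(derive (flat k) y (l v)) deriveE//.
rewrite -[X in 'd _ _ X]mulr1 -[_ * 1]/(l v *: (1 : R)) linearZ/= -deriveE//.
by rewrite derive_val.
Qed.

Lemma flat_algebra_derive {R : realType} {V : normedModType R} (f : V -> R) (v : V) :
  flat_algebra f -> (forall x, derivable f x v) /\ flat_algebra ('D_v f).
Proof.
elim=> {f} [c|k l c lin cl|f g Ff [df Fdf] Fg [dg Fdg]|f g Ff [df Fdf] Fg [dg Fdg]].
- split=> [x|]; first exact: derivable_cst.
  rewrite (_ : 'D_v _ = fun=> 0); first exact: flat_algebra_cst.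
  by apply/funext => x; rewrite derive_cst.
- split=> [x|]; first by case: (is_derive_flat_comp k l c x v lin).
  rewrite (_ : 'D_v _ = fun x => (l v) *
      (- k%:R * flat k.+1 (l x + c) + flat k.+2 (l x + c))).
    apply: flat_algebraM; first exact: flat_algebra_cst.
    apply: flat_algebraD; last exact: flat_algebra_flat.
    by apply: flat_algebraM; [exact: flat_algebra_cst|exact: flat_algebra_flat].
  by apply/funext => x; case: (is_derive_flat_comp k l c x v lin).
- split=> [x|]; first exact: derivableD.
  rewrite (_ : 'D_v _ = fun x => 'D_v f x + 'D_v g x); first exact: flat_algebraD.
  by apply/funext => x; rewrite deriveD.
- split=> [x|]; first exact: derivableM.
  rewrite (_ : 'D_v _ = fun x => f x * 'D_v g x + g x * 'D_v f x).
    by apply: flat_algebraD; exact: flat_algebraM.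
  by apply/funext => x; rewrite deriveM.
Qed.

Lemma flat_algebra_smooth {R : realType} {V : normedModType R} (U : set V) (f : V -> R) :
  flat_algebra f -> smooth_on U f.
Proof.
move=> Ff s; have {}Ff : flat_algebra (foldr (fun v h => 'D_v h) f s).
  by elim: s => //= v s /(flat_algebra_derive _ v)[].
move=> h x _; split; first exact: flat_algebra_continuous.
by move=> v; have [] := flat_algebra_derive _ v Ff.
Qed.

(** * Bump functions and boxes in space-time *)

Lemma flat0_le1 {R : realType} (x : R) : flat 0 x <= 1.
Proof.
rewrite /flat; case: ifPn => // x0; rewrite expr0 mul1r -expR0 ler_expR.
by rewrite oppr_le0 invr_ge0 ltW.
Qed.

Lemma flat_gt0 {R : realType} k (x : R) : 0 < x -> 0 < flat k x.
Proof.
by move=> x0; rewrite /flat x0 mulr_gt0 ?expR_gt0// exprn_gt0// invr_gt0.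
Qed.

Lemma flat_eq0 {R : realType} k (x : R) : x <= 0 -> flat k x = 0.
Proof. by rewrite /flat leNgt => /negbTE ->. Qed.

Lemma flat0_nondecreasing {R : realType} (x y : R) : 0 < x -> x <= y ->
  flat 0 x <= flat 0 y.
Proof.
move=> x0 xy; have y0 : 0 < y by exact: lt_le_trans xy.
by rewrite /flat x0 y0 !expr0 !mul1r ler_expR lerN2 lef_pV2.
Qed.

(** A smooth cutoff, positive exactly for c - r < u < c + r. Both arguments are a linear form in [u]
    plus a constant, the shape that [flat_algebra_flat] accepts. *)
Definition tent {R : realType} (r c u : R) : R :=
  flat 0 (- u + (c + r)) * flat 0 (u + (r - c)).

Lemma tent_ge0 {R : realType} (r c u : R) : 0 <= tent r c u.
Proof. by rewrite mulr_ge0 ?flat_ge0. Qed.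

Lemma tent_le1 {R : realType} (r c u : R) : tent r c u <= 1.
Proof. by rewrite mulr_ile1 ?flat_ge0 ?flat0_le1. Qed.

Lemma tent_eq0 {R : realType} (r c u : R) :
  ~~ (c - r <= u <= c + r) -> tent r c u = 0.
Proof.
rewrite negb_and -!ltNge /tent => /orP[h|h].
  by rewrite [X in _ * X]flat_eq0 ?mulr0//; lra.
by rewrite [X in X * _]flat_eq0 ?mul0r//; lra.
Qed.

Lemma tent_ge {R : realType} (r c u : R) : 0 < r ->
  c - r / 2 <= u <= c + r / 2 -> flat 0 (r / 2) ^+ 2 <= tent r c u.
Proof.
move=> r0 /andP[h1 h2]; rewrite expr2 /tent.
by apply: ler_pM; rewrite ?flat_ge0//; apply: flat0_nondecreasing; lra.
Qed.

Definition smooth_bump {R : realType} {d : nat} (r : R) (z0 z : R * 'rV[R]_d) : R :=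
  tent r z0.1 z.1 * \prod_(i < d) tent r (z0.2 ord0 i) (z.2 ord0 i).

(** The closed cube of center [c] and half-side [r], written with corner vectors so that
    [measurable_box] and [lebesgue_rV_box] apply to it. *)
Definition box {R : realType} {d : nat} (c : 'rV[R]_d) (r : R) : set 'rV[R]_d :=
  [set x | forall i, (c - const_mx r) ord0 i <= x ord0 i <= (c + const_mx r) ord0 i].

Definition tbox {R : realType} {d : nat} (z : R * 'rV[R]_d) (r : R) :
  set (R * 'rV[R]_d) := `[z.1 - r, z.1 + r]%classic `*` box z.2 r.

Section smooth_bump.
Context {R : realType} {d : nat}.
Implicit Types (z : R * 'rV[R]_d) (c : 'rV[R]_d) (r : R).

Lemma boxP c r x : box c r x <-> forall i, c ord0 i - r <= x ord0 i <= c ord0 i + r.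
Proof. by split=> h i; have := h i; rewrite !mxE. Qed.

Lemma measurable_cbox c r : measurable (box c r).
Proof. exact: measurable_box. Qed.

Lemma measurable_tbox z r : measurable (tbox z r).
Proof. by apply: measurableX; [exact: measurable_itv|exact: measurable_cbox]. Qed.

Lemma lebesgue_cbox c r : 0 <= r -> lebesgue_rV d (box c r) = ((r *+ 2) ^+ d)%:E.
Proof.
move=> r0; rewrite lebesgue_rV_box => [|i]; last by rewrite !mxE; lra.
congr EFin; rewrite -[in RHS](card_ord d) -prodr_const.
by apply: eq_bigr => i _; rewrite !mxE; lra.
Qed.

Lemma lebesgue_citv (a r : R) : 0 <= r ->
  lebesgue_measure `[a - r, a + r]%classic = (r *+ 2)%:E.
Proof.
move=> r0; rewrite lebesgue_measure_itv/= lte_fin.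
case: ltP => h; first by congr EFin; lra.
by congr EFin; lra.
Qed.

Lemma lebesgue_tbox z r : 0 <= r ->
  (lebesgue_measure \x lebesgue_rV d)%E (tbox z r) = ((r *+ 2) ^+ d.+1)%:E.
Proof.
move=> r0; rewrite product_measure1E//=; last exact: measurable_cbox.
by rewrite lebesgue_citv// lebesgue_cbox// -EFinM -exprS.
Qed.

Lemma bump_ge0 r z0 z : 0 <= smooth_bump r z0 z.
Proof. by rewrite mulr_ge0 ?tent_ge0// prodr_ge0// => i _; exact: tent_ge0. Qed.

Lemma bump_le1 r z0 z : smooth_bump r z0 z <= 1.
Proof.
rewrite mulr_ile1 ?tent_ge0 ?tent_le1// ?prodr_ge0// => [i _|].
  exact: tent_ge0.
by rewrite prodr_ile1// => i _; rewrite tent_ge0 tent_le1.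
Qed.

Lemma bump_eq0 r z0 z : ~ tbox z0 r z -> smooth_bump r z0 z = 0.
Proof.
move=> nz; apply/eqP/negP => /negP; rewrite mulf_eq0 negb_or => /andP[h1 h2].
apply: nz; split.
  rewrite /= in_itv/=; apply: contraNT h1 => /tent_eq0 ->; exact: eqxx.
apply/boxP => i; apply: contraTT h2 => /tent_eq0 h.
by rewrite negbK (bigD1 i)//= h mul0r.
Qed.

(** On the box of half the radius, each of the d + 1 tents is at least [flat 0 (r / 2) ^+ 2]. *)
Lemma bump_ge r z0 z : 0 < r -> tbox z0 (r / 2) z ->
  flat 0 (r / 2) ^+ 2 ^+ d.+1 <= smooth_bump r z0 z.
Proof.
move=> r0 [/=]; rewrite in_itv/= => h1 /boxP h2.
rewrite exprS; apply: ler_pM; rewrite ?exprn_ge0 ?flat_ge0//; first exact: tent_ge.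
rewrite -[X in _ ^+ X](card_ord d) -prodr_const; apply: ler_prod => i _.
by rewrite exprn_ge0 ?flat_ge0//= tent_ge.
Qed.

Lemma flat_algebra_tent (V : normedModType R) (l : V -> R) r (c : R) :
  (forall (a : R) u v, l (a *: u + v) = a * l u + l v) -> continuous l ->
  flat_algebra (fun x => tent r c (l x)).
Proof.
move=> lin cl; apply: flat_algebraM; apply: flat_algebra_flat => //.
- by move=> a u v; rewrite lin; ring.
- by move=> x; apply: cvgN; exact: cl.
Qed.

Lemma flat_algebra_bump r z0 : flat_algebra (smooth_bump r z0).
Proof.
apply: flat_algebraM.
  by apply: (flat_algebra_tent _ fst) => // x; exact: cvg_fst.
elim: (index_enum _) => [|i s IH].
  by under eq_fun do rewrite big_nil; exact: flat_algebra_cst.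
under eq_fun do rewrite big_cons; apply: flat_algebraM => //.
apply: (flat_algebra_tent _ (fun z : R * 'rV[R]_d => z.2 ord0 i)) => [a u v|x].
  by rewrite /= !mxE.
apply: (@continuous_comp _ _ _ snd (fun y : 'rV[R]_d => y ord0 i)).
  exact: cvg_snd.
exact: coord_continuous.
Qed.

Lemma compact_tbox z r : compact (tbox z r).
Proof.
apply: compact_setX; first exact: segment_compact.
rewrite (_ : box _ _ = [set v : 'rV[R]_d | forall i,
    `[z.2 ord0 i - r, z.2 ord0 i + r]%classic (v ord0 i)]).
  apply: (@rV_compact _ _ (fun i => `[z.2 ord0 i - r, z.2 ord0 i + r]%classic)).
  by move=> i; exact: segment_compact.
apply/seteqP; split=> x; first by move/boxP => h i; rewrite /= in_itv/= h.
by move=> h; apply/boxP => i; have := h i; rewrite /= in_itv.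
Qed.

(** The points where the function is nonzero lie in [tbox z0 r], which is compact, hence closed; so
    the closure of these points stays in the box. *)
Lemma test_function_bump (U : set (R * 'rV[R]_d)) (c : R[i]) r z0 :
  tbox z0 r `<=` U -> test_function U (fun z => c * (smooth_bump r z0 z)%:C).
Proof.
move=> sU.
have cl : closure [set z | c * (smooth_bump r z0 z)%:C <> 0] `<=` tbox z0 r.
  have /closure_id -> : closed (tbox z0 r).
    by apply: compact_closed; [exact: norm_hausdorff|exact: compact_tbox].
  apply: closure_subset => z /= cz; apply: contrapT => /bump_eq0 b0.
  by apply: cz; rewrite b0 mulr0.
split.
- split; apply: flat_algebra_smooth.
    rewrite (_ : (fun _ => _) = fun z => complex.Re c * smooth_bump r z0 z).
      by apply: flat_algebraM; [exact: flat_algebra_cst|exact: flat_algebra_bump].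
    by apply/funext => z; case: c {cl} => a b /=; ring.
  rewrite (_ : (fun _ => _) = fun z => complex.Im c * smooth_bump r z0 z).
    by apply: flat_algebraM; [exact: flat_algebra_cst|exact: flat_algebra_bump].
  by apply/funext => z; case: c {cl} => a b /=; ring.
- by apply: subclosed_compact cl; [exact: closed_closure|exact: compact_tbox].
- exact: subset_trans cl sU.
Qed.

Lemma nbhs_box c (P : set 'rV[R]_d) :
  nbhs c P -> \forall r \near 0^'+, box c r `<=` P.
Proof.
move=> /nbhs_ballP[e /= e0 eP]; near=> r => x /boxP h.
apply: eP; split => // i j; rewrite ord1 /ball/= ltr_distlC.
have re : r < e by near: r; exact: nbhs_right_lt.
by have := h j; lra.
Unshelve. all: end_near. Qed.

End smooth_bump.

(** * Bounds on integrals and L^2 norms by constants on sets *)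

(* The integral is total, and on nonnegative functions it is a supremum over
   simple functions: no measurability is needed. *)
Lemma ge0_le_integral_total (d : measure_display) (T : measurableType d)
    (R : realType) (mu : {measure set T -> \bar R}) (D : set T)
    (f g : T -> \bar R) :
  (forall x, D x -> 0 <= f x)%E -> (forall x, D x -> f x <= g x)%E ->
  (\int[mu]_(x in D) f x <= \int[mu]_(x in D) g x)%E.
Proof.
move=> f0 fg.
rewrite !ge0_integralE//; last by move=> x Dx; rewrite (le_trans (f0 x Dx)) ?fg.
apply: ge_ereal_sup => _ [h /= hf <-]; apply: ereal_sup_ubound.
exists h => // x; apply: le_trans (hf x) _.
by rewrite !patchE; case: ifPn => // /set_mem /fg.
Qed.

Lemma integral_ge_indic (d : measure_display) (T : measurableType d)
    (R : realType) (mu : {measure set T -> \bar R}) (D A : set T) (c : R)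
    (f : T -> \bar R) :
  measurable D -> measurable A -> A `<=` D -> 0 <= c ->
  (forall x, D x -> 0 <= f x)%E -> (forall x, A x -> c%:E <= f x)%E ->
  (c%:E * mu A <= \int[mu]_(x in D) f x)%E.
Proof.
move=> mD mA AD c0 f0 cf.
rewrite -(setIidl AD) -integral_indic// -ge0_integralZl_EFin//;
  last exact/measurable_EFinP.
apply: ge0_le_integral_total => x Dx; first by rewrite -EFinM lee_fin mulr_ge0.
rewrite -EFinM indicE; have [/set_mem/cf|_] := boolP (x \in A).
  by rewrite mulr1.
by rewrite mulr0 f0.
Qed.

Lemma integral_le_indic (d : measure_display) (T : measurableType d)
    (R : realType) (mu : {measure set T -> \bar R}) (D A : set T) (c : R)
    (f : T -> \bar R) :
  measurable D -> measurable A -> A `<=` D -> 0 <= c ->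
  (forall x, D x -> 0 <= f x)%E -> (forall x, A x -> f x <= c%:E)%E ->
  (forall x, D x -> ~ A x -> f x = 0)%E ->
  (\int[mu]_(x in D) f x <= c%:E * mu A)%E.
Proof.
move=> mD mA AD c0 f0 fc fA.
rewrite -[X in mu X](setIidl AD) -integral_indic// -ge0_integralZl_EFin//;
  last exact/measurable_EFinP.
apply: ge0_le_integral_total => // x Dx.
rewrite -EFinM indicE; have [/set_mem/fc|nA] := boolP (x \in A).
  by rewrite mulr1.
by rewrite mulr0 fA// => /mem_set; apply/negP.
Qed.

Lemma L2norm_on_ge (d : measure_display) (T : measurableType d)
    (R : realType) (mu : {measure set T -> \bar R}) (D A : set T) (c m : R)
    (g : T -> R[i]) :
  measurable D -> measurable A -> A `<=` D -> 0 <= c -> mu A = m%:E ->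
  (forall x, A x -> c <= normc (g x)) ->
  ((c * m `^ 2^-1)%:E <= L2norm_on mu D g)%E.
Proof.
move=> mD mA AD c0 muA cg.
have m0 : 0 <= m by rewrite -lee_fin -muA.
have -> : (c * m `^ 2^-1)%:E = ((c ^+ 2 * m)%:E `^ 2^-1)%E.
  by rewrite poweR_EFin powRM ?sqr_ge0// -powR_mulrn// -powRrM divff// powRr1.
apply: gt0_ler_poweR; rewrite ?invr_ge0 ?in_itv/= ?leey ?andbT//.
- by rewrite lee_fin mulr_ge0// sqr_ge0.
- by apply: integral_ge0 => x _; rewrite lee_fin sqr_ge0.
rewrite EFinM -muA; apply: integral_ge_indic => //; first exact: sqr_ge0.
  by move=> x _; rewrite lee_fin sqr_ge0.
by move=> x /cg cgx; rewrite lee_fin ler_pXn2r ?nnegrE ?normc_ge0.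
Qed.

Lemma L2norm_on_le (d : measure_display) (T : measurableType d)
    (R : realType) (mu : {measure set T -> \bar R}) (D A : set T) (c m : R)
    (g : T -> R[i]) :
  measurable D -> measurable A -> A `<=` D -> 0 <= c -> mu A = m%:E ->
  (forall x, A x -> normc (g x) <= c) -> (forall x, D x -> ~ A x -> g x = 0) ->
  (L2norm_on mu D g <= (c * m `^ 2^-1)%:E)%E.
Proof.
move=> mD mA AD c0 muA cg gA.
have m0 : 0 <= m by rewrite -lee_fin -muA.
have -> : (c * m `^ 2^-1)%:E = ((c ^+ 2 * m)%:E `^ 2^-1)%E.
  by rewrite poweR_EFin powRM ?sqr_ge0// -powR_mulrn// -powRrM divff// powRr1.
apply: gt0_ler_poweR; rewrite ?invr_ge0 ?in_itv/= ?leey ?andbT//.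
- by apply: integral_ge0 => x _; rewrite lee_fin sqr_ge0.
- by rewrite lee_fin mulr_ge0// sqr_ge0.
rewrite EFinM -muA; apply: integral_le_indic => //; first exact: sqr_ge0.
- by move=> x _; rewrite lee_fin sqr_ge0.
- by move=> x /cg cgx; rewrite lee_fin ler_pXn2r ?nnegrE ?normc_ge0.
- by move=> x Dx /gA ->//; rewrite normc0 expr0n.
Qed.

(** The real integral is [fine] of the extended one, and so takes the default value 0 when the
    latter is infinite. The upper bound excludes this case; this is why the two bounds are proved
    together. *)
Lemma Rintegral_bounds (d : measure_display) (T : measurableType d)
    (R : realType) (mu : {measure set T -> \bar R}) (D A B : set T) (c c' m m' : R)
    (f : T -> R) :
  measurable D -> measurable A -> measurable B -> A `<=` D -> B `<=` D ->
  0 <= c -> 0 <= c' -> mu A = m%:E -> mu B = m'%:E ->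
  (forall x, D x -> 0 <= f x) -> (forall x, A x -> c <= f x) ->
  (forall x, B x -> f x <= c') -> (forall x, D x -> ~ B x -> f x = 0) ->
  c * m <= \int[mu]_(x in D) f x <= c' * m'.
Proof.
move=> mD mA mB AD BD c0 c'0 muA muB f0 cf fc fB.
have lo : (c%:E * mu A <= \int[mu]_(x in D) (f x)%:E)%E.
  by apply: integral_ge_indic => // x /= Hx; rewrite lee_fin ?f0 ?cf.
have hi : (\int[mu]_(x in D) (f x)%:E <= c'%:E * mu B)%E.
  apply: integral_le_indic => // x Dx; rewrite ?lee_fin ?f0 ?fc//.
  by move=> nB; rewrite fB.
rewrite /Rintegral; rewrite muA in lo; rewrite muB in hi.
by move: lo hi; case: (integral _ _ _) => [r| |]; rewrite -!EFinM ?lee_fin// => -> ->.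
Qed.

(** * Lower bound for the solution with a bump as source *)

(** If [t] is within [r] of [s0 + tau] and [s] within [r] of [s0], then [t - s] is within [2 r] of
    [tau], where the real part of [p * c] lies between [m] and [M]. The integrand thus has
    nonnegative real part, bounded below on the half-size box, whose sides have length [r]. The
    bound obtained does not involve [s0]. *)
Lemma source_term_bump_ge {R : realType} {d : nat} (Omega : set 'rV[R]_d)
    (p : R * 'rV[R]_d * 'rV[R]_d -> R[i]) (c : R[i]) (r s0 tau t m M : R)
    (x y0 : 'rV[R]_d) :
  open Omega -> 0 < r -> r < s0 -> r *+ 2 < tau ->
  s0 + tau - r <= t <= s0 + tau + r -> box y0 r `<=` Omega -> 0 <= m ->
  (forall u y, tau - r *+ 2 <= u <= tau + r *+ 2 -> box y0 r y ->
    m <= complex.Re (p (u, x, y) * c) <= M) ->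
  m * flat 0 (r / 2) ^+ 2 ^+ d.+1 * r ^+ d * r <=
  complex.Re (source_term Omega p (fun z => c * (smooth_bump r (s0, y0) z)%:C) t x).
Proof.
move=> oO r0 rs0 rtau /andP[t1 t2] BO m0 pc.
set K := flat 0 (r / 2) ^+ 2 ^+ d.+1.
have K0 : 0 <= K by rewrite !exprn_ge0// flat_ge0.
have mO : measurable Omega by exact: open_measurable_rV.
have half : box y0 (r / 2) `<=` box y0 r.
  by move=> y /boxP h; apply/boxP => i; have := h i; lra.
have vhalf : lebesgue_rV d (box y0 (r / 2)) = (r ^+ d)%:E.
  by rewrite lebesgue_cbox; [congr (EFin (_ ^+ _)); lra|lra].
have vfull : lebesgue_rV d (box y0 r) = ((r *+ 2) ^+ d)%:E.
  by rewrite lebesgue_cbox// ltW.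
have M0 : 0 <= M.
  have /pc : tau - r *+ 2 <= tau <= tau + r *+ 2 by lra.
  have y0B : box y0 r y0 by apply/boxP => i; lra.
  by move=> /(_ _ y0B); lra.
have ReE s y : complex.Re (p (t - s, x, y) * (c * (smooth_bump r (s0, y0) (s, y))%:C)) =
    complex.Re (p (t - s, x, y) * c) * smooth_bump r (s0, y0) (s, y).
  by case: (p _) => a b; case: c {pc} => a' b' /=; ring.
(* The space integral at time [s]: the lower bound is positive only on the half-size time window,
   the upper bound only on the full one. *)
have inner s : 0 < s < t ->
    (if s0 - r / 2 <= s <= s0 + r / 2 then m * K else 0) * r ^+ d <=
    complex.Re (source_integrand Omega p (fun z => c * (smooth_bump r (s0, y0) z)%:C) t x s)
    <= (if s0 - r <= s <= s0 + r then M else 0) * (r *+ 2) ^+ d.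
  move=> /andP[s1 s2].
  have h y : box y0 r y -> s0 - r <= s <= s0 + r ->
      m <= complex.Re (p (t - s, x, y) * c) <= M.
    by move=> By hs; apply: pc => //; lra.
  apply: (@Rintegral_bounds _ _ _ _ _ (box y0 (r / 2)) (box y0 r)) => //.
  - exact: measurable_cbox.
  - exact: measurable_cbox.
  - exact: subset_trans BO.
  - by case: ifP => // _; rewrite mulr_ge0.
  - by case: ifP.
  - move=> y _; rewrite ReE.
    have [[/= hs By]|nB] := pselect (tbox (s0, y0) r (s, y)); last first.
      by rewrite bump_eq0// mulr0.
    move: hs; rewrite in_itv/= => hs; rewrite mulr_ge0 ?bump_ge0//.
    by have := h y By hs; lra.
  - move=> y By; rewrite ReE; case: ifPn => hs.
      apply: ler_pM => //.
        by have /andP[] : m <= complex.Re (p (t - s, x, y) * c) <= M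
          by apply: h; [exact: half|lra].
      by apply: bump_ge => //; split => //=; rewrite in_itv.
    have [[/= hs' By']|nB] := pselect (tbox (s0, y0) r (s, y)); last first.
      by rewrite bump_eq0// mulr0.
    move: hs'; rewrite in_itv/= => hs'; rewrite mulr_ge0 ?bump_ge0//.
    by have := h y By' hs'; lra.
  - move=> y By; rewrite ReE; case: ifPn => hs.
      have /andP[h1 h2] := h y By hs.
      by rewrite -[leRHS]mulr1 ler_pM ?bump_ge0 ?bump_le1//; lra.
    by rewrite bump_eq0 ?mulr0// => -[/=]; rewrite in_itv/= (negbTE hs).
  - by move=> y Oy nB; rewrite ReE bump_eq0 ?mulr0// => -[].
(* The upper bound is added so that [Rintegral_bounds] applies to the time integral too. *)
suff /andP[] : m * K * r ^+ d * r <=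
    complex.Re (source_term Omega p (fun z => c * (smooth_bump r (s0, y0) z)%:C) t x)
    <= M * (r *+ 2) ^+ d * (r *+ 2) by [].
apply: (@Rintegral_bounds _ _ _ lebesgue_measure _
  `[s0 - r / 2, s0 + r / 2]%classic `[s0 - r, s0 + r]%classic) => //.
(* Both windows lie inside []0, t[]: [s0 - r] is positive since [r < s0], and
   [s0 + r < s0 + tau - r <= t] since [2 r < tau]. *)
- by move=> s /=; rewrite !in_itv/=; lra.
- by move=> s /=; rewrite !in_itv/=; lra.
- by rewrite !mulr_ge0// exprn_ge0// ltW.
- by rewrite mulr_ge0// exprn_ge0//; lra.
- by apply: etrans (lebesgue_citv _ _ _) _; [lra|congr EFin; lra].
- by apply: lebesgue_citv; exact: ltW.
- move=> s /=; rewrite in_itv/= => /inner/andP[h _]; apply: le_trans h.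
  by case: ifP => _; rewrite ?mul0r// !mulr_ge0// exprn_ge0// ltW.
- move=> s /=; rewrite in_itv/= => hs.
  have /inner/andP[] : 0 < s < t by lra.
  by rewrite hs.
- move=> s /=; rewrite in_itv/= => hs.
  have /inner/andP[_] : 0 < s < t by lra.
  by rewrite hs.
(* Outside the full window both bounds of [inner] are 0. *)
- move=> s /=; rewrite !in_itv/= => /inner h /negP/negbTE hs.
  move: h; rewrite hs mul0r.
  rewrite (_ : (_ <= s <= _) = false) ?mul0r//; last first.
    by apply: contraFF hs; lra.
  by move=> h; apply/eqP; rewrite eq_le andbC.
Qed.

(** * Growth of the quotients *)

Lemma lee_ratio {R : realType} (X Y : \bar R) (a b : R) :
  0 <= a -> (a%:E <= X)%E -> (0 < Y)%E -> (Y <= b%:E)%E -> ((a / b)%:E <= X / Y)%E.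
Proof.
move=> a0 aX; case: Y => [y| |]//; rewrite lte_fin lee_fin => y0 yb.
rewrite inver gt_eqF// EFinM; apply: lee_pmul; rewrite ?lee_fin ?invr_ge0//.
  by rewrite (le_trans (ltW y0)).
by rewrite lef_pV2// posrE// (lt_le_trans y0).
Qed.

(** The quotient is at least (a / b) exp(n (alpha - beta)), hence at least (a / b) n (alpha - beta),
    so it even tends to infinity. A value [u n] equal to infinity is allowed. *)
Lemma limn_esup_ratio_expR {R : realType} (u v : nat -> \bar R)
    (a b alpha beta : R) :
  0 < a -> 0 < b -> beta < alpha ->
  (forall n, (a * expR (n%:R * alpha))%:E <= u n)%E ->
  (forall n, 0 < v n)%E -> (forall n, v n <= (b * expR (n%:R * beta))%:E)%E ->
  limn_esup (fun n => u n / v n)%E = +oo%E.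
Proof.
move=> a0 b0 ab hu v0 hv; apply: (cvg_limn_einf_sup _).2; apply/cvgeyPge => A.
near=> n; apply: le_trans
  (@lee_ratio _ _ _ (a * expR (n%:R * alpha)) _ _ _ (v0 n) (hv n)) => //.
  rewrite lee_fin invfM mulrACA -expRN -expRD.
  have ge : n%:R * (alpha - beta) <= expR (n%:R * alpha - n%:R * beta).
    by apply: le_trans (expR_ge1Dx _); lra.
  have ab0 : 0 < a / b by rewrite divr_gt0.
  rewrite mulrC -ler_pdivrMr//; apply: le_trans ge.
  rewrite -ler_pdivrMr ?subr_gt0//.
  by near: n; exact: nbhs_infty_ger.
by rewrite mulr_ge0 ?expR_ge0// ltW.
Unshelve. all: end_near. Qed.

(** * Moduli, weights and the representation formula *)

Lemma normc_real {R : realType} (k : R) : normc k%:C = `|k|.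
Proof. by rewrite /= expr0n/= addr0 sqrtr_sqr. Qed.

Lemma Re_le_normc {R : realType} (z : R[i]) : complex.Re z <= normc z.
Proof.
case: z => a b /=; apply: le_trans (ler_norm _) _.
by rewrite -sqrtr_sqr ler_wsqrtr// lerDl sqr_ge0.
Qed.

Lemma normc_weight {R : realType} {d : nat} (phi a : 'rV[R]_d -> R) g z :
  0 <= a z.2 -> normc (weight phi a g z) = expR (z.1 * phi z.2) * a z.2 * normc (g z).
Proof.
by move=> a0; rewrite /weight normcM normc_real ger0_norm// mulr_ge0 ?expR_ge0.
Qed.

Lemma measurable_time_space {R : realType} {d : nat} (Omega : set 'rV[R]_d) :
  open Omega -> measurable (time_space Omega).
Proof.
by move=> oO; apply: measurableX; [exact: measurable_itv|exact: open_measurable_rV].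
Qed.

Lemma test_function0 {R : realType} {V : normedModType R} (U : set V) :
  test_function U (fun=> 0).
Proof.
have e : [set x : V | (0 : R[i]) <> 0] = set0 by apply/seteqP; split.
split; rewrite ?e ?closure0//; last exact: compact0.
by split; apply: flat_algebra_smooth; exact: flat_algebra_cst.
Qed.

Lemma initial_term0 {R : realType} {d : nat} (Omega : set 'rV[R]_d) p t x :
  initial_term Omega p (fun=> 0) t x = 0.
Proof.
rewrite /initial_term /cintegral; under eq_Rintegral do rewrite mulr0.
under [X in _ +i* X]eq_Rintegral do rewrite mulr0.
by rewrite /Rintegral !integral0.
Qed.

(** Convergence of the integrals is taken from the representation of the mild solution with zero
    initial data and source [f]; the identity is the hypothesis on [w]. *)
Lemma source_term_represented {R : realType} {d : nat} (Omega : set 'rV[R]_d)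
    (oOmega : open Omega)
    (S : R -> L2 (lebesgue_on oOmega) -> L2 (lebesgue_on oOmega))
    (p : R * 'rV[R]_d * 'rV[R]_d -> R[i]) (f : R * 'rV[R]_d -> R[i])
    (w : R * 'rV[R]_d -> R[i]) :
  fundamental_solution S p -> test_function (time_space Omega) f ->
  (forall t x, 0 < t -> Omega x -> w (t, x) = source_term Omega p f t x) ->
  represented Omega p (fun=> 0) f (fun t x => w (t, x)).
Proof.
move=> [_ fs] tf wE.
have [w' _ rep] := fs _ _ (test_function0 Omega) tf.
move=> t t0; apply: filterS (rep t t0) => x H Ox.
have [conv _] := H Ox; split => //.
by rewrite wE// initial_term0 add0r.
Qed.

(** * The kernel near a point where it does not vanish *)

(* [c] is the conjugate of [p (tau, x, y)]. *)
Lemma kernel_rotation {R : realType} {d : nat}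
    (p : R * 'rV[R]_d * 'rV[R]_d -> R[i]) tau x y :
  {for (tau, x, y), continuous (fun z => complex.Re (p z))} ->
  {for (tau, x, y), continuous (fun z => complex.Im (p z))} ->
  p (tau, x, y) <> 0 ->
  exists c m M, [/\ c <> 0, 0 < m & \forall r \near 0^'+, forall u x' y',
    tau - r *+ 2 <= u <= tau + r *+ 2 -> box x r x' -> box y r y' ->
    m <= complex.Re (p (u, x', y') * c) <= M].
Proof.
move=> cRe cIm p0; set z0 := (tau, x, y).
pose c := complex.Re (p z0) +i* (- complex.Im (p z0)).
pose h z := complex.Re (p z * c).
pose N := complex.Re (p z0) ^+ 2 + complex.Im (p z0) ^+ 2.
have hE z : h z = complex.Re (p z) * complex.Re (p z0) +
    complex.Im (p z) * complex.Im (p z0).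
  by rewrite /h /c; case: (p z) => a b /=; ring.
have hz0 : h z0 = N by rewrite hE /N; ring.
have ch : h z @[z --> z0] --> N.
  rewrite -hz0 (_ : h = fun z => complex.Re (p z) * complex.Re (p z0) +
    complex.Im (p z) * complex.Im (p z0)); last exact/funext.
  by apply: cvgD; apply: cvgMl.
have N0 : 0 < N.
  have [re0|re0] := eqVneq (complex.Re (p z0)) 0; last first.
    by rewrite ltr_wpDr ?sqr_ge0// exprn_even_gt0.
  have [im0|im0] := eqVneq (complex.Im (p z0)) 0; last first.
    by rewrite ltr_wpDl ?sqr_ge0// exprn_even_gt0.
  by exfalso; apply: p0; move: re0 im0; rewrite -/z0; case: (p z0) => a b /= -> ->.
(* [N] is the squared modulus of [p z0], and the value of [h] at [z0]; by continuity [h] stays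
   between [N / 2] and [2 N] nearby. *)
exists c, (N / 2), (N * 2); split.
- move=> c0; have /= re0 := congr1 (@complex.Re R) c0.
  have /= /eqP := congr1 (@complex.Im R) c0; rewrite oppr_eq0 => /eqP im0.
  by move: N0; rewrite /N re0 im0 expr0n/= addr0 ltxx.
- by lra.
have : \forall z \near z0, N / 2 <= h z <= N * 2.
  near=> z; apply/andP; split.
    by near: z; apply: (cvgr_ge N) => //; lra.
  by near: z; apply: (cvgr_le N) => //; lra.
move=> [[P Q] /= [[[P1 P2] /= [nP1 nP2] P12] nQ] PQ].
have [e /= e0 eP] := nP1.
near=> r => u x' y' hu hx hy.
apply: (PQ (u, x', y')); split => /=.
  apply: (P12 (u, x')); split => /=.
    apply: eP; rewrite /= ltr_distlC.
    have : r < e / 3 by near: r; apply: nbhs_right_lt; lra.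
    by lra.
  by move: hx; apply: (near (nbhs_box _ _ nP2) r).
by move: hy; apply: (near (nbhs_box _ _ nQ) r).
Unshelve. all: end_near. Qed.

(** The point [(1, x0, y0)] belongs to the support, so its neighborhood with space components in [P]
    and [Q] and free time meets the set where [p] is nonzero. The time 1 is arbitrary and [tau] may
    be far from it. *)
Lemma kernel_neq0_near {R : realType} {d : nat} (Omega P Q : set 'rV[R]_d)
    (p : R * 'rV[R]_d * 'rV[R]_d -> R[i]) x0 y0 :
  support_in (time_space2 Omega) p = time_space2 Omega ->
  Omega x0 -> Omega y0 -> nbhs x0 P -> nbhs y0 Q ->
  exists tau x y, [/\ 0 < tau, Omega x, Omega y, P x /\ Q y & p (tau, x, y) <> 0].
Proof.
move=> supp Ox Oy Px Qy.
have : time_space2 Omega (1, x0, y0).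
  by split => //; split => //=; rewrite in_itv/= andbT.
rewrite -supp => -[_ /(_ [set z | P z.1.2 /\ Q z.2])[]].
  exists ([set z | P z.2], Q) => [|[z y] []//]; split => //=.
  by exists (setT, P) => [|z []//]; split => //=; exact: filterT.
move=> [[tau x] y] [[[[/= tau0 Ox'] Oy'] p0] [/= Px' Qy']].
exists tau, x, y; split => //.
by move: tau0; rewrite in_itv/= andbT.
Qed.

(** * Exponential weights and weighted norms on boxes *)

(** Replacing [s] by the center [s0] of a time window changes the exponent [s * b] by at most [|b|],
    so the loss is a factor independent of [s0]. *)
Lemma expR_weight_le {R : realType} (b f s s0 : R) :
  0 < s -> `|s - s0| <= 1 -> f <= b -> expR (s * f) <= expR (`|b|) * expR (s0 * b).
Proof.
move=> s0' ss fb; rewrite -expRD ler_expR.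
apply: (@le_trans _ _ (s * b)); first by rewrite ler_pM2l.
rewrite -lerBlDr -mulrBl; apply: le_trans (ler_norm _) _.
by rewrite normrM ler_piMl.
Qed.

Lemma expR_weight_ge {R : realType} (b f s s0 : R) :
  0 < s -> `|s - s0| <= 1 -> b <= f -> expR (- `|b|) * expR (s0 * b) <= expR (s * f).
Proof.
move=> s0' ss fb; rewrite -expRD ler_expR.
apply: (@le_trans _ _ (s * b)); last by rewrite ler_pM2l.
rewrite -lerBrDr -mulrBl lerNl; apply: le_trans (ler_norm _) _.
by rewrite normrN normrM ler_piMl.
Qed.

Lemma tbox_time_space {R : realType} {d : nat} (Omega : set 'rV[R]_d) z r :
  r < z.1 -> box z.2 r `<=` Omega -> tbox z r `<=` time_space Omega.
Proof.
move=> rz BO [t x] [/=]; rewrite in_itv/= => ht /BO Ox; split => //=.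
by rewrite in_itv/= andbT; lra.
Qed.

Lemma weighted_norm_ge {R : realType} {d : nat} (Omega : set 'rV[R]_d)
    (phi a : 'rV[R]_d -> R) g z (r c : R) :
  open Omega -> 0 <= r -> 0 <= c -> r < z.1 -> box z.2 r `<=` Omega ->
  (forall z', tbox z r z' -> c <= normc (weight phi a g z')) ->
  ((c * ((r *+ 2) ^+ d.+1) `^ 2^-1)%:E <= weighted_norm Omega phi a g)%E.
Proof.
move=> oO r0 c0 rz BO cg.
apply: (@L2norm_on_ge _ _ R (lebesgue_measure \x lebesgue_rV d)%E _ (tbox z r)) => //.
- exact: measurable_time_space.
- exact: measurable_tbox.
- exact: tbox_time_space.
- exact: lebesgue_tbox.
Qed.

Lemma weighted_norm_le {R : realType} {d : nat} (Omega : set 'rV[R]_d)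
    (phi a : 'rV[R]_d -> R) g z (r c : R) :
  open Omega -> 0 <= r -> 0 <= c -> r < z.1 -> box z.2 r `<=` Omega ->
  (forall z', tbox z r z' -> normc (weight phi a g z') <= c) ->
  (forall z', ~ tbox z r z' -> g z' = 0) ->
  (weighted_norm Omega phi a g <= (c * ((r *+ 2) ^+ d.+1) `^ 2^-1)%:E)%E.
Proof.
move=> oO r0 c0 rz BO cg g0.
apply: (@L2norm_on_le _ _ R (lebesgue_measure \x lebesgue_rV d)%E _ (tbox z r)) => //.
- exact: measurable_time_space.
- exact: measurable_tbox.
- exact: tbox_time_space.
- exact: lebesgue_tbox.
- by move=> z' _ /g0; rewrite /weight => ->; rewrite mulr0.
Qed.

(** * Construction of the sequence *)

Theorem theorem1p3 (R : realType) (d : nat) (Omega : set 'rV[R]_d)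
    (oOmega : open Omega)
    (D : set (L2 (lebesgue_on oOmega)))
    (L : L2 (lebesgue_on oOmega) -> L2 (lebesgue_on oOmega))
    (S : R -> L2 (lebesgue_on oOmega) -> L2 (lebesgue_on oOmega))
    (p : R * 'rV[R]_d * 'rV[R]_d -> R[i]) :
  linear_operator D L -> closed_operator D L -> dense D ->
  C0_semigroup S -> infinitesimal_generator S D (fun u => - L u) ->
  fundamental_solution S p ->
  support_in (time_space2 Omega) p = time_space2 Omega ->
  forall a1 a2 phi : 'rV[R]_d -> R,
    (forall x, Omega x -> 0 < a1 x) -> {within Omega, continuous a1} ->
    (forall x, Omega x -> 0 < a2 x) -> {within Omega, continuous a2} ->
    {within Omega, continuous phi} ->
    (exists x y, [/\ Omega x, Omega y & phi x <> phi y]) ->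
  exists (w : nat -> R * 'rV[R]_d -> R[i]) (f : nat -> R * 'rV[R]_d -> R[i]),
    (forall n,
      [/\ forall x, Omega x -> w n (0, x) = 0,
          represented Omega p (fun=> 0) (f n) (fun t x => w n (t, x)),
          forall t x, 0 < t -> Omega x -> w n (t, x) = source_term Omega p (f n) t x,
          test_function (time_space Omega) (f n)
        & (0 < weighted_norm Omega phi a2 (f n) < +oo)%E]) /\
    limn_esup (fun n => (weighted_norm Omega phi a1 (w n) /
                         weighted_norm Omega phi a2 (f n))%E) = +oo%E.
Proof.
move=> _ _ _ _ _ fs supp a1 a2 phi a10 ca1 a20 ca2 cphi nonconst.
have cO (g : 'rV[R]_d -> R) : {within Omega, continuous g} ->
    forall x, Omega x -> {for x, continuous g}.
  by rewrite continuous_open_subspace// => cg x Ox; apply: cg; rewrite inE.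
have {nonconst}[x0 [y0 [Ox0 Oy0 xy]]] :
    exists x y, [/\ Omega x, Omega y & phi y < phi x].
  have [x [y [Ox Oy /eqP]]] := nonconst.
  by rewrite neq_lt => /orP[h|h]; [exists y, x|exists x, y].
(* The two points cutting the interval from [phi y0] to [phi x0] into thirds, so that
   [phi y0 < beta < alpha < phi x0]. *)
pose alpha := (phi y0 + phi x0 *+ 2) / 3; pose beta := (phi y0 *+ 2 + phi x0) / 3.
have ba : beta < alpha by rewrite /alpha /beta; lra.
have [tau [xs [ys [tau0 Oxs Oys [axs bys] p0]]]] : exists tau x y,
    [/\ 0 < tau, Omega x, Omega y, alpha < phi x /\ phi y < beta & p (tau, x, y) <> 0].
  apply: (@kernel_neq0_near _ _ _ [set x | alpha < phi x] [set y | phi y < beta]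
    _ _ _ supp Ox0 Oy0).
    by apply: (cvgr_gt _ (cO _ cphi _ Ox0)); rewrite /alpha; lra.
  by apply: (cvgr_lt _ (cO _ cphi _ Oy0)); rewrite /beta; lra.
have zsU : time_space2 Omega (tau, xs, ys).
  by split => //; split => //=; rewrite in_itv/= andbT.
have [[sRe sIm] _] := fs.
have [c [m [M [c0 m0 near_p]]]] := @kernel_rotation _ _ p tau xs ys
  (sRe [::] _ zsU).1 (sIm [::] _ zsU).1 p0.
have near_x : \forall x \near xs, [/\ Omega x, alpha < phi x & a1 xs / 2 < a1 x].
  near=> x; split; near: x; first exact: open_nbhs_nbhs.
    exact: (cvgr_gt _ (cO _ cphi _ Oxs)).
  by apply: (cvgr_gt _ (cO _ ca1 _ Oxs)); have := a10 _ Oxs; lra.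
have a1xs := a10 _ Oxs; have a2ys := a20 _ Oys.
(* A lower bound for [phi] near [ys]; it serves to show that the weighted norm of the source is
   positive. *)
pose gamma := phi ys - 1.
have near_y : \forall y \near ys, [/\ Omega y, gamma < phi y < beta &
    a2 ys / 2 < a2 y < a2 ys * 2].
  near=> y; split; last 2 first.
  - apply/andP; split; near: y.
      by apply: (cvgr_gt _ (cO _ cphi _ Oys)); rewrite /gamma; lra.
    exact: (cvgr_lt _ (cO _ cphi _ Oys)).
  - apply/andP; split; near: y.
      by apply: (cvgr_gt _ (cO _ ca2 _ Oys)); lra.
    by apply: (cvgr_lt _ (cO _ ca2 _ Oys)); lra.
  - by near: y; exact: open_nbhs_nbhs.
(* A single radius for all conditions: those on [phi], [a1], [a2] and [Omega] near [xs] and [ys],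
   and the bounds on the kernel. It is fixed before [n]. *)
near ((0 : R)^'+) => r.
have r0 : 0 < r by near: r; exact: nbhs_right_gt.
have r1 : r < 1 by near: r; apply: nbhs_right_lt.
have rtau : r *+ 2 < tau.
  by have : r < tau / 2 by [near: r; apply: nbhs_right_lt; lra]; lra.
have rx : box xs r `<=` [set x | [/\ Omega x, alpha < phi x & a1 xs / 2 < a1 x]].
  by near: r; exact: nbhs_box.
have ry : box ys r `<=` [set y | [/\ Omega y, gamma < phi y < beta &
    a2 ys / 2 < a2 y < a2 ys * 2]].
  by near: r; exact: nbhs_box.
have rp : forall u x y, tau - r *+ 2 <= u <= tau + r *+ 2 -> box xs r x ->
    box ys r y -> m <= complex.Re (p (u, x, y) * c) <= M.
  by near: r.
have rxO : box xs r `<=` Omega by move=> x /rx[].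
have ryO : box ys r `<=` Omega by move=> y /ry[].
(* The time center is [n + 1] rather than [n], so that with [r < 1] the support stays in positive
   times also for [n = 0]. *)
pose f n z := c * (smooth_bump r (n.+1%:R, ys) z)%:C.
(* The value 0 at nonpositive times gives the initial condition at once. *)
pose w n (z : R * 'rV[R]_d) := if 0 < z.1 then source_term Omega p (f n) z.1 z.2 else 0.
have n1 n : 1 <= n.+1%:R :> R by rewrite ler1n.
have tf n : test_function (time_space Omega) (f n).
  apply: test_function_bump; apply: tbox_time_space => //=.
  by have := n1 n; lra.
have wE n t x : 0 < t -> Omega x -> w n (t, x) = source_term Omega p (f n) t x.
  by move=> t0 _; rewrite /w /= t0.
have nc0 : 0 < normc c.
  rewrite lt_neqAle normc_ge0 andbT; apply/eqP => /esym/eq0_normc.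
  exact: c0.
have vol_gt0 (e : R) : 0 < e -> 0 < ((e *+ 2) ^+ d.+1) `^ 2^-1.
  by move=> e0; rewrite powR_gt0// exprn_gt0//; lra.
pose K : R := flat 0 (r / 2) ^+ 2 ^+ d.+1.
have K0 : 0 < K by rewrite /K !exprn_gt0// flat_gt0//; lra.
have f_le n : (weighted_norm Omega phi a2 (f n) <= ((expR `|beta| * expR (n.+1%:R * beta)
    * (a2 ys * 2) * normc c) * ((r *+ 2) ^+ d.+1) `^ 2^-1)%:E)%E.
  apply: (weighted_norm_le _ _ _ _ (n.+1%:R, ys)) => //=.
  - by rewrite !mulr_ge0 ?expR_ge0// ltW.
  - by have := n1 n; lra.
  - move=> [s y] [/=]; rewrite in_itv/= => hs /ry [Oy hphi ha2].
    have s0 : 0 < s by have := n1 n; lra.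
    have a2y := a20 _ Oy.
    rewrite normc_weight/= ?(ltW (a20 _ _))// normcM normc_real.
    rewrite (ger0_norm (bump_ge0 _ _ _)).
    apply: ler_pM.
    + by rewrite mulr_ge0 ?expR_ge0// ltW.
    + by rewrite mulr_ge0 ?normc_ge0 ?bump_ge0.
    + apply: ler_pM; rewrite ?expR_ge0 ?(ltW a2y)//; [|lra].
      by apply: expR_weight_le => //; [rewrite ler_norml; lra|lra].
    + by rewrite ler_piMr ?normc_ge0 ?bump_le1.
  - by move=> z nz; rewrite /f bump_eq0// mulr0.
(* Only the half-size box is used, since the bump has no positive lower bound on the full one. *)
have f_gt0 n : (0 < weighted_norm Omega phi a2 (f n))%E.
  apply: (@lt_le_trans _ _ ((expR (- `|gamma|) * expR (n.+1%:R * gamma)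
    * (a2 ys / 2) * (normc c * K)) * ((r / 2 *+ 2) ^+ d.+1) `^ 2^-1)%:E).
    rewrite lte_fin mulr_gt0//; last by apply: vol_gt0; lra.
    by rewrite !mulr_gt0// expR_gt0.
  apply: (weighted_norm_ge _ _ _ _ (n.+1%:R, ys)) => //=; first by lra.
  - by rewrite !mulr_ge0 ?expR_ge0// ltW.
  - by have := n1 n; lra.
  - by move=> y /boxP h; apply/ryO/boxP => i; have := h i; lra.
  - move=> [s y] tb; have := tb; move=> [/=]; rewrite in_itv/= => hs hy.
    have /ry [Oy hphi ha2] : box ys r y.
      by move/boxP : hy => h; apply/boxP => i; have := h i; lra.
    have s0 : 0 < s by have := n1 n; lra.
    have a2y := a20 _ Oy.
    rewrite normc_weight/= ?(ltW (a20 _ _))// normcM normc_real.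
    rewrite (ger0_norm (bump_ge0 _ _ _)).
    apply: ler_pM; rewrite ?mulr_ge0 ?expR_ge0 ?normc_ge0 ?(ltW K0)//; [lra| |].
    + apply: ler_pM; rewrite ?mulr_ge0 ?expR_ge0//; [lra| |lra].
      by apply: expR_weight_ge => //; [rewrite ler_norml; lra|lra].
    + by rewrite ler_pM2l// bump_ge.
(* The lower bound of [source_term_bump_ge], the same for all [n]. *)
pose W := m * K * r ^+ d * r.
have W0 : 0 < W by rewrite /W !mulr_gt0// exprn_gt0.
(* The box is centered at time [n + 1 + tau] and at [xs]: there [phi] exceeds [alpha], and the
   modulus of the solution is at least its real part, hence at least [W]. *)
have w_ge n : (((expR (- `|alpha|) * expR ((n.+1%:R + tau) * alpha)
    * (a1 xs / 2) * W) * ((r *+ 2) ^+ d.+1) `^ 2^-1)%:E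
    <= weighted_norm Omega phi a1 (w n))%E.
  apply: (weighted_norm_ge _ _ _ _ (n.+1%:R + tau, xs)) => //=.
  - by rewrite mulr_ge0 ?(ltW W0)// !mulr_ge0 ?expR_ge0// ltW.
  - by have := n1 n; lra.
  - move=> [t x] [/=]; rewrite in_itv/= => ht hx; have [Ox hphi ha1] := rx _ hx.
    have t0 : 0 < t by have := n1 n; lra.
    rewrite normc_weight/= ?(ltW (a10 _ _))//.
    apply: ler_pM; rewrite ?(ltW W0) ?mulr_ge0 ?expR_ge0//; [lra| |].
    + apply: ler_pM; rewrite ?mulr_ge0 ?expR_ge0//; [lra| |lra].
      by apply: expR_weight_ge => //; [rewrite ler_norml; lra|lra].
    + rewrite wE//; apply: le_trans (Re_le_normc _).
      apply: (@source_term_bump_ge _ _ _ _ _ _ _ tau _ _ M) => //.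
      * by have := n1 n; lra.
      * exact: ltW.
      * by move=> u y hu hy; exact: rp.
exists w, f; split.
  move=> n; split.
  - by move=> x _; rewrite /w /= ltxx.
  - exact: source_term_represented fs (tf n) (wE n).
  - exact: wE.
  - exact: tf.
  - by rewrite f_gt0/= (le_lt_trans (f_le n))// ltry.
pose v := ((r *+ 2) ^+ d.+1) `^ 2^-1; have v0 : 0 < v := vol_gt0 _ r0.
(* The shifts by [1 + tau] and by 1 in the exponents are absorbed into the constants, leaving
   [n * alpha] and [n * beta]. *)
apply: (@limn_esup_ratio_expR _ _ _
  (expR (- `|alpha|) * expR ((1 + tau) * alpha) * (a1 xs / 2) * W * v)
  (expR `|beta| * expR beta * (a2 ys * 2) * normc c * v) alpha beta) => //.
- by rewrite mulr_gt0// mulr_gt0// !mulr_gt0 ?expR_gt0.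
- by rewrite mulr_gt0// mulr_gt0// !mulr_gt0 ?expR_gt0.
- move=> n; apply: le_trans (w_ge n); rewrite lee_fin -/v.
  rewrite (_ : (n.+1%:R + tau) * alpha = (1 + tau) * alpha + n%:R * alpha).
    by rewrite expRD; lra.
  by rewrite -natr1; ring.
- move=> n; apply: le_trans (f_le n) _; rewrite lee_fin -/v.
  rewrite (_ : n.+1%:R * beta = beta + n%:R * beta).
    by rewrite expRD; lra.
  by rewrite -natr1; ring.
Unshelve. all: end_near. Qed.
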